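(* Let $k$ be a positive integer and let $\mathbf a\in\mathscr S_k$ be such that $\mathcal s(\mathbf a)>0$. Assume there is a real number $\rho>1$ such that $d_l=\mathcal O(l^{\rho-1})$ for $l\ge k+1$. Then $\kappa_{\mathbf a}(s,u)=\sum_{m,n\ge1}a_{m,n}m^{-s}n^{-\bar u}$ is a positive semi-definite Dirichlet series kernel on $\mathbb H_\rho\times\mathbb H_\rho$. Moreover, for every integer $n\ge k+1$ the analytic symbol $A_{n,\mathbf a}(s)=\sum_{m\ge1}a_{m,n}m^{-s}$ is a Dirichlet polynomial, and the Dirichlet polynomials form a dense subspace of the associated reproducing kernel Hilbert space $\mathscr H_{\mathbf a}$.
   Context: Class $\mathscr S_k$: given a $k\times k$ complex matrix $\mathbf b=(b_{i,j})$, complex numbers $c_{k+1},c_{k+2},\dots$ and positive reals $d_{k+1},d_{k+2},\dots$, let $\mathbf a=(a_{m,n})_{m,n\ge1}$ be the block matrix $\begin{pmatrix}\mathbf b&\mathbf c\\\mathbf c^*&\mathbf d\end{pmatrix}$, where $\mathbf c$ is the $k\times\infty$ matrix all of whose rows equal $(c_{k+1},c_{k+2},\dots)$ and $\mathbf d=\mathrm{diag}(d_{k+1},d_{k+2},\dots)$; i.e. $a_{i,j}=b_{i,j}$ for $i,j\le k$, $a_{i,k+l}=c_{k+l}$ and $a_{k+l,i}=\overline{c_{k+l}}$ for $i\le k$, $l\ge1$, $a_{k+l,k+l}=d_{k+l}$, and $a_{k+l,k+l'}=0$ for $l\ne l'$. $\mathbf a\in\mathscr S_k$ if $\mathbf b$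 is positive semi-definite and $\sum_{l\ge1}|c_{k+l}|^2/d_{k+l}<\infty$; then $\mathcal s(\mathbf a)=\lambda_{\min}(\mathbf b)-k\sum_{l\ge1}|c_{k+l}|^2/d_{k+l}$, with $\lambda_{\min}$ the minimal eigenvalue. $\mathbb H_\rho=\{\Re s>\rho\}$. A Dirichlet series kernel on $\mathbb H_\rho$ is $\kappa_{\mathbf a}$ such that $(s,u)\mapsto\kappa_{\mathbf a}(s,\bar u)$ is regularly convergent on $\mathbb H_\rho\times\mathbb H_\rho$ (double series convergent and all row/column series convergent). $\mathscr H_{\mathbf a}$ is the reproducing kernel Hilbert space of functions on $\mathbb H_\rho$ with kernel $\kappa_{\mathbf a}$. A Dirichlet polynomial is a finite sum $\sum_{n=1}^Nc_nn^{-s}$. *)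

(* Defs.v *)
(* MathComp + MathComp-Analysis, complex numbers R[i] from
   mathcomp-real-closed over an abstract R : realType. *)
From HB Require Import structures.
From mathcomp Require Import all_boot all_order all_algebra.
From mathcomp Require Import all_classical all_reals all_analysis.
From mathcomp Require Import complex.
Import Order.TTheory GRing.Theory Num.Theory.
Import numFieldNormedType.Exports.

Set Implicit Arguments.
Unset Strict Implicit.
Unset Printing Implicit Defensive.

Local Open Scope ring_scope.
Local Open Scope classical_set_scope.

Section Defs.
Variable R : realType.
Local Notation C := R[i].

(* complex conjugation *)
Definition cconj (z : C) : C := (z^*)%C.

(* n^{-s} = exp(-s log n) for n >= 1 *)
Definition npow (n : nat) (s : C) : C :=
  ((expR (- complex.Re s * ln n%:R))%:C *
   ((cos (complex.Im s * ln n%:R))%:C - 'i * (sin (complex.Im s * ln n%:R))%:C))%C.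

(* half plane H_rho = { Re s > rho } *)
Definition Hplane (rho : R) : Type := {s : C | rho < complex.Re s}.

(* convergence of a complex series sum_{n>=1} u n to l *)
Definition sconv (u : nat -> C) (l : C) : Prop :=
  forall e : R, 0 < e -> exists N : nat, forall M : nat, (N <= M)%N ->
    `| \sum_(1 <= n < M.+1) u n - l | < (e%:C)%C.

(* convergence of the double series sum_{m,n>=1} t m n to l
   (rectangular partial sums, joint limit M,N -> oo) *)
Definition dconv (t : nat -> nat -> C) (l : C) : Prop :=
  forall e : R, 0 < e -> exists N0 : nat, forall M N : nat,
    (N0 <= M)%N -> (N0 <= N)%N ->
    `| \sum_(1 <= m < M.+1) \sum_(1 <= n < N.+1) t m n - l | < (e%:C)%C.

(* regular convergence: double series convergent and all rows/columns
   series convergent *)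
Definition regular_conv (t : nat -> nat -> C) : Prop :=
  (exists l, dconv t l) /\
  (forall m, (1 <= m)%N -> exists l, sconv (fun n => t m n) l) /\
  (forall n, (1 <= n)%N -> exists l, sconv (fun m => t m n) l).

(* value of the double series *)
Definition dsum (t : nat -> nat -> C) : C := xget 0 (dconv t).

(* the kernel kappa_a(s,u) = sum a_{m,n} m^{-s} n^{-conj u} *)
Definition kappa (a : nat -> nat -> C) (s u : C) : C :=
  dsum (fun m n => a m n * npow m s * npow n (cconj u)).

(* kappa_a is a Dirichlet series kernel on H_rho *)
Definition dirichlet_series_kernel (rho : R) (a : nat -> nat -> C) : Prop :=
  forall s u : C, rho < complex.Re s -> rho < complex.Re u ->
    regular_conv (fun m n => a m n * npow m s * npow n u).

Definition kernel_on (rho : R) (a : nat -> nat -> C) : Hplane rho -> Hplane rho -> C :=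
  fun s u => kappa a (sval s) (sval u).

(* positive semi-definite kernel *)
Definition psd_kernel (T : Type) (K : T -> T -> C) : Prop :=
  forall (N : nat) (p : 'I_N -> T) (x : 'I_N -> C),
    0 <= \sum_(i < N) \sum_(j < N) x i * cconj (x j) * K (p i) (p j).

(* reproducing kernel Hilbert space: V a set of functions T -> C with
   inner product ip (linear in the first argument) *)
Definition is_RKHS (T : Type) (K : T -> T -> C)
    (V : set (T -> C)) (ip : (T -> C) -> (T -> C) -> C) : Prop :=
  V (fun _ => 0) /\
  (forall f g, V f -> V g -> V (f \+ g)) /\
  (forall (z : C) f, V f -> V (fun t => z * f t)) /\
  (forall (z : C) f g h, V f -> V g -> V h ->
      ip (fun t => z * f t + g t) h = z * ip f h + ip g h) /\
  (forall f g, V f -> V g -> ip f g = cconj (ip g f)) /\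
  (forall f, V f -> 0 <= ip f f /\ (ip f f = 0 -> f = (fun _ => 0))) /\
      (* completeness *)
      (forall u : nat -> (T -> C), (forall n, V (u n)) ->
        (forall e : R, 0 < e -> exists N, forall m n, (N <= m)%N -> (N <= n)%N ->
            `| ip (u m \- u n) (u m \- u n) | < (e%:C)%C) ->
        exists f, V f /\ forall e : R, 0 < e -> exists N, forall n, (N <= n)%N ->
            `| ip (u n \- f) (u n \- f) | < (e%:C)%C) /\
      (* reproducing property *)
      (forall u : T, V (fun s => K s u) /\
         forall f, V f -> ip f (fun s => K s u) = f u).

(* Dirichlet polynomials, as functions on H_rho *)
Definition is_dirpoly (rho : R) (f : Hplane rho -> C) : Prop :=
  exists (N : nat) (cf : nat -> C),
    forall s : Hplane rho, f s = \sum_(1 <= n < N.+1) cf n * npow n (sval s).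

(* ---- the class S_k ---- *)

(* entry b_{m,n} (1 <= m,n <= k) of a k x k matrix *)
Definition bentry (k : nat) (b : 'M[C]_k) (m n : nat) : C :=
  match @insub _ (fun i => (i < k)%N) 'I_k m.-1,
        @insub _ (fun i => (i < k)%N) 'I_k n.-1 with
  | Some i, Some j => b i j
  | _, _ => 0
  end.

(* the infinite matrix a = (b c ; c^* d), indices m,n >= 1 *)
Definition amat (k : nat) (b : 'M[C]_k) (c : nat -> C) (d : nat -> R)
    (m n : nat) : C :=
  if (m == 0%N) || (n == 0%N) then 0
  else if (m <= k)%N && (n <= k)%N then bentry b m n
  else if (m <= k)%N then c n
  else if (n <= k)%N then cconj (c m)
  else if m == n then ((d m)%:C)%C
  else 0.

(* positive semi-definite (Hermitian) matrix *)
Definition psd_mx (k : nat) (b : 'M[C]_k) : Prop :=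
  (forall i j, b j i = cconj (b i j)) /\
  (forall x : 'I_k -> C, 0 <= \sum_(i < k) \sum_(j < k) cconj (x i) * b i j * x j).

(* minimal eigenvalue of a Hermitian matrix (its spectrum is real) *)
Definition lambda_min (k : nat) (b : 'M[C]_k) : R :=
  inf [set r : R | eigenvalue b ((r%:C)%C)].

(* the terms |c_{k+l}|^2 / d_{k+l}, l >= 1 (indexed from 0) *)
Definition cd_terms (k : nat) (c : nat -> C) (d : nat -> R) (l : nat) : R :=
  (complex.Re (c (k + l.+1)%N) ^+ 2 + complex.Im (c (k + l.+1)%N) ^+ 2)
    / d (k + l.+1)%N.

Definition in_Sk (k : nat) (b : 'M[C]_k) (c : nat -> C) (d : nat -> R) : Prop :=
  (forall l, (k < l)%N -> 0 < d l) /\ psd_mx b /\ cvgn (series (cd_terms k c d)).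

(* s(a) = lambda_min(b) - k * sum_l |c_{k+l}|^2 / d_{k+l} *)
Definition s_val (k : nat) (b : 'M[C]_k) (c : nat -> C) (d : nat -> R) : R :=
  lambda_min b - k%:R * limn (series (cd_terms k c d)).

End Defs.

Arguments kernel_on [R] rho a _ _.
Arguments is_dirpoly [R] rho f.

(* Main.v *)
Require Import Defs.
From HB Require Import structures.
From mathcomp Require Import all_boot all_order all_algebra.
From mathcomp Require Import all_classical all_reals all_analysis.
From mathcomp Require Import complex.
From mathcomp Require Import ring lra.
Import Order.TTheory GRing.Theory Num.Theory.
Import numFieldNormedType.Exports.
Local Open Scope ring_scope.
Local Open Scope classical_set_scope.

Set Implicit Arguments.
Unset Strict Implicit.
Unset Printing Implicit Defensive.

(* Write Q(y) = sum a_{m,n} y_m conj(y_n) on finitely supported sequences and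
   w_n = 1 for n <= k, w_n = d_n for n > k. Since s(a) > 0, the spectral theorem
   for b and a weighted AM-GM inequality for the cross terms give
   Q(y) >= c0 * sum w_n |y_n|^2 for some c0 > 0. A function g lies in the RKHS with
   ||g||^2 <= C as soon as |sum conj(z_i) g(p_i)|^2 <= C * ||sum z_i K(., p_i)||^2
   for all finite combinations of kernel functions, and the right-hand norm is
   lim_M Q of the truncation to n <= M of y_n = sum conj(z_i) n^{-p_i}. With the
   lower bound on Q and Cauchy-Schwarz, a function sum gamma_n n^{-s} is therefore
   in the RKHS with ||.||^2 <= c0^{-1} sum |gamma_n|^2 / w_n. This applies to each
   n^{-s}, and to the difference between K(., u) and the Dirichlet polynomial
   obtained by truncating the double series to m, n <= N, whose norm tends to 0;
   finite combinations of the K(., u) are dense. *)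

(** * Real-valued modulus on the complex numbers *)

Section ComplexModulus.
Variable R : realType.
Implicit Types z w : R[i].

(** The norm of [R[i]] takes values in [R[i]]; this copy lives in [R], so that estimates become
    inequalities between reals. *)
Definition cabs z : R := Num.sqrt (complex.Re z ^+ 2 + complex.Im z ^+ 2).

Lemma norm_cabs z : `|z| = ((cabs z)%:C)%C.
Proof. exact: normc_def. Qed.

Lemma cabs_ge0 z : 0 <= cabs z. Proof. exact: sqrtr_ge0. Qed.

Lemma sqr_cabs z : cabs z ^+ 2 = complex.Re z ^+ 2 + complex.Im z ^+ 2.
Proof. by rewrite sqr_sqrtr// addr_ge0 ?sqr_ge0. Qed.

Lemma norm_ltC z (e : R) : (`|z| < (e%:C)%C) = (cabs z < e).
Proof. by rewrite norm_cabs ltcR. Qed.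

Lemma cabsM z w : cabs (z * w) = cabs z * cabs w.
Proof. by apply: complexI; rewrite rmorphM/= -!norm_cabs normrM. Qed.

Lemma cabsD z w : cabs (z + w) <= cabs z + cabs w.
Proof. by rewrite -lecR rmorphD/= -!norm_cabs ler_normD. Qed.

Lemma cabsB z w : cabs (z - w) = cabs (w - z).
Proof. by apply: complexI; rewrite -!norm_cabs distrC. Qed.

Lemma cabs0 : cabs 0 = 0.
Proof. by apply: complexI; rewrite -norm_cabs normr0. Qed.

Lemma cabs0_eq0 z : cabs z = 0 -> z = 0.
Proof. by move=> z0; apply/eqP; rewrite -normr_eq0 norm_cabs z0. Qed.

Lemma cabs_conj z : cabs (cconj z) = cabs z.
Proof. by case: z => x y; rewrite /cabs/= sqrrN. Qed.

Lemma cabs_real (x : R) : 0 <= x -> cabs ((x%:C)%C) = x.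
Proof. by move=> x0; rewrite /cabs/= expr0n/= addr0 sqrtr_sqr ger0_norm. Qed.

Lemma cabs_sum (I : Type) (r : seq I) (P : pred I) (F : I -> R[i]) :
  cabs (\sum_(i <- r | P i) F i) <= \sum_(i <- r | P i) cabs (F i).
Proof.
elim/big_ind2 : _ => [|z1 x1 z2 x2 h1 h2|//]; first by rewrite cabs0.
exact: (le_trans (cabsD _ _)) (lerD h1 h2).
Qed.

Lemma Re_le_cabs z : complex.Re z <= cabs z.
Proof.
apply: le_trans (ler_norm _) _; rewrite -sqrtr_sqr ler_wsqrtr// lerDl.
exact: sqr_ge0.
Qed.

Lemma absRe_le_cabs z : `|complex.Re z| <= cabs z.
Proof. by rewrite -sqrtr_sqr ler_wsqrtr// lerDl sqr_ge0. Qed.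

Lemma absIm_le_cabs z : `|complex.Im z| <= cabs z.
Proof. by rewrite -sqrtr_sqr ler_wsqrtr// lerDr sqr_ge0. Qed.

Lemma cabs_le_ReIm z : cabs z <= `|complex.Re z| + `|complex.Im z|.
Proof.
rewrite -(@ler_pXn2r _ 2)// ?nnegrE ?cabs_ge0 ?addr_ge0//.
by rewrite sqr_cabs sqrrD !real_normK ?num_real// addrAC lerDl mulrn_wge0 ?mulr_ge0.
Qed.

Lemma mul_cconj z : z * cconj z = (((cabs z) ^+ 2)%:C)%C.
Proof. by rewrite sqr_cabs add_Re2_Im2 sqr_normc. Qed.

Lemma Re_D z w : complex.Re (z + w) = complex.Re z + complex.Re w.
Proof. by case: z w => [? ?] []. Qed.
Lemma Im_D z w : complex.Im (z + w) = complex.Im z + complex.Im w.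
Proof. by case: z w => [? ?] []. Qed.
Lemma Re_N z : complex.Re (- z) = - complex.Re z.
Proof. by case: z. Qed.
Lemma Im_N z : complex.Im (- z) = - complex.Im z.
Proof. by case: z. Qed.
Lemma Re_M z w : complex.Re (z * w) =
  complex.Re z * complex.Re w - complex.Im z * complex.Im w.
Proof. by case: z w => [? ?] []. Qed.
Lemma Im_M z w : complex.Im (z * w) =
  complex.Re z * complex.Im w + complex.Im z * complex.Re w.
Proof. by case: z w => [? ?] []. Qed.
Lemma Re_cconj z : complex.Re (cconj z) = complex.Re z.
Proof. by case: z. Qed.
Lemma Im_cconj z : complex.Im (cconj z) = - complex.Im z.
Proof. by case: z. Qed.

Lemma cconjD z w : cconj (z + w) = cconj z + cconj w.
Proof. exact: rmorphD. Qed.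
Lemma cconjM z w : cconj (z * w) = cconj z * cconj w.
Proof. exact: rmorphM. Qed.
Lemma cconjK z : cconj (cconj z) = z.
Proof. exact: conjcK. Qed.
Lemma cconj_sum (I : Type) (r : seq I) (P : pred I) (F : I -> R[i]) :
  cconj (\sum_(i <- r | P i) F i) = \sum_(i <- r | P i) cconj (F i).
Proof. exact: (rmorph_sum (@conjc R)). Qed.

Lemma Re_sum (I : Type) (r : seq I) (P : pred I) (F : I -> R[i]) :
  complex.Re (\sum_(i <- r | P i) F i) = \sum_(i <- r | P i) complex.Re (F i).
Proof. by elim/big_ind2 : _ => // ? ? ? ? <- <-; rewrite Re_D. Qed.

Lemma lec0_ReIm z : (0 <= z) <-> (complex.Im z = 0 /\ 0 <= complex.Re z).
Proof. by rewrite lecE/=; split=> [/andP[/eqP->]|[-> ->]]//; rewrite eqxx. Qed.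

Lemma sqr_cabsD z w : cabs (z + w) ^+ 2 <= 2 * cabs z ^+ 2 + 2 * cabs w ^+ 2.
Proof.
have := cabsD z w; have := cabs_ge0 z; have := cabs_ge0 w.
have := cabs_ge0 (z + w).
set a := cabs (z + w); set x := cabs z; set y := cabs w => a0 y0 x0 axy.
have : a ^+ 2 <= (x + y) ^+ 2 by rewrite ler_pXn2r ?nnegrE ?addr_ge0.
have := sqr_ge0 (x - y); lra.
Qed.

End ComplexModulus.

(** * Cauchy-Schwarz inequalities for finite sums *)

Section FiniteCauchySchwarz.
Variable R : realType.

Lemma sum_CS (I : Type) (r : seq I) (P : pred I) (f g : I -> R) :
  (\sum_(i <- r | P i) f i * g i) ^+ 2 <=
  (\sum_(i <- r | P i) f i ^+ 2) * (\sum_(i <- r | P i) g i ^+ 2).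
Proof.
have e F G : \sum_(i <- r | P i) \sum_(j <- r | P j) (F i * G j) =
    (\sum_(i <- r | P i) F i) * (\sum_(j <- r | P j) G j) :> R.
  by rewrite mulr_suml; apply: eq_bigr => i _; rewrite mulr_sumr.
(* Lagrange's identity. *)
have : 0 <= \sum_(i <- r | P i) \sum_(j <- r | P j) (f i * g j - f j * g i) ^+ 2.
  by apply: sumr_ge0 => i _; apply: sumr_ge0 => j _; exact: sqr_ge0.
have -> : \sum_(i <- r | P i) \sum_(j <- r | P j) (f i * g j - f j * g i) ^+ 2 =
   \sum_(i <- r | P i) \sum_(j <- r | P j) (f i ^+ 2 * g j ^+ 2) +
   \sum_(i <- r | P i) \sum_(j <- r | P j) (g i ^+ 2 * f j ^+ 2) -
   2 * \sum_(i <- r | P i) \sum_(j <- r | P j) ((f i * g i) * (f j * g j)).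
  rewrite mulr_sumr -big_split/= -sumrB; apply: eq_bigr => i _.
  rewrite mulr_sumr -big_split/= -sumrB; apply: eq_bigr => j _; ring.
by rewrite !e; set A := \sum_(i <- r | P i) f i ^+ 2; lra.
Qed.

(** The modulus of each product is split as [(|f i| / sqrt (w i)) * (sqrt (w i) * |g i|)] before the
    real inequality is applied. *)
Lemma csum_CS (I : Type) (r : seq I) (P : pred I) (w : I -> R) (f g : I -> R[i]) :
  (forall i, P i -> 0 < w i) ->
  cabs (\sum_(i <- r | P i) f i * g i) ^+ 2 <=
  (\sum_(i <- r | P i) cabs (f i) ^+ 2 / w i) *
  (\sum_(i <- r | P i) w i * cabs (g i) ^+ 2).
Proof.
move=> w0.
apply: (@le_trans _ _ ((\sum_(i <- r | P i) (cabs (f i) / Num.sqrt (w i)) *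
    (Num.sqrt (w i) * cabs (g i))) ^+ 2)).
  rewrite ler_pXn2r ?nnegrE ?cabs_ge0//; last first.
    by apply: sumr_ge0 => i _; rewrite !mulr_ge0 ?invr_ge0 ?sqrtr_ge0 ?cabs_ge0.
  apply: (le_trans (cabs_sum _ _ _)); apply: ler_sum => i Pi.
  by rewrite mulrA divfK ?cabsM// gt_eqF// sqrtr_gt0 w0.
apply: (le_trans (sum_CS _ _ _ _)).
rewrite le_eqVlt; apply/orP; left; apply/eqP; congr (_ * _); apply: eq_bigr => i Pi.
  by rewrite expr_div_n (sqr_sqrtr (ltW (w0 _ Pi))).
by rewrite exprMn (sqr_sqrtr (ltW (w0 _ Pi))).
Qed.

End FiniteCauchySchwarz.

(** * Limits of complex sequences *)

Section ComplexLimits.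
Variable R : realType.
Implicit Types (z : nat -> R[i]) (l : R[i]).

Definition cvc z l := forall e : R, 0 < e ->
  exists N, forall M, (N <= M)%N -> cabs (z M - l) < e.

(** Completeness of the reals is applied to the real and imaginary parts separately. *)
Lemma cvc_cauchy z :
  (forall e : R, 0 < e -> exists N, forall M, (N <= M)%N -> cabs (z M - z N) < e) ->
  exists l, cvc z l.
Proof.
move=> cz.
have key (f : R[i] -> R) : (forall a b, f (a - b) = f a - f b) ->
    (forall a, `|f a| <= cabs a) -> exists x, forall e : R, 0 < e ->
    exists N, forall M, (N <= M)%N -> `|f (z M) - x| < e.
  move=> fB fle.
  have /cvg_ex[x /= cx] : cvgn (f \o z).
    apply/cauchy_cvgP/cauchy_exP => _/posnumP[e].
    have [N hN] := cz _ [gt0 of e%:num]; exists (f (z N)); exists N => // M /= NM.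
    by rewrite /ball/= -fB; apply: (le_lt_trans (fle _)); rewrite cabsB hN.
  exists x => e e0; move/cvgrPdist_lt: cx => /(_ _ e0)[N _ hN].
  by exists N => M NM; rewrite distrC; exact: hN.
have [|x hx] := key (@complex.Re R) _ (@absRe_le_cabs R).
  by move=> a b; rewrite Re_D Re_N.
have [|y hy] := key (@complex.Im R) _ (@absIm_le_cabs R).
  by move=> a b; rewrite Im_D Im_N.
exists (x +i* y)%C => e e0; have e20 : 0 < e / 2 by rewrite divr_gt0.
have [N1 h1] := hx _ e20; have [N2 h2] := hy _ e20.
exists (maxn N1 N2) => M; rewrite geq_max => /andP[M1 M2].
apply: (le_lt_trans (cabs_le_ReIm _)); rewrite Re_D Re_N Im_D Im_N/=.
have := h1 _ M1; have := h2 _ M2; lra.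
Qed.

Lemma cvc_cst l : cvc (fun=> l) l.
Proof. by move=> e e0; exists 0%N => M _; rewrite subrr cabs0. Qed.

Lemma cvcD z1 z2 l1 l2 : cvc z1 l1 -> cvc z2 l2 ->
  cvc (fun M => z1 M + z2 M) (l1 + l2).
Proof.
move=> h1 h2 e e0; have e20 : 0 < e / 2 by rewrite divr_gt0.
have [N1 k1] := h1 _ e20; have [N2 k2] := h2 _ e20.
exists (maxn N1 N2) => M; rewrite geq_max => /andP[M1 M2].
rewrite opprD addrACA; apply: (le_lt_trans (cabsD _ _)).
have := k1 _ M1; have := k2 _ M2; lra.
Qed.

Lemma cvcZ x z l : cvc z l -> cvc (fun M => x * z M) (x * l).
Proof.
move=> h e e0; have x0 : 0 < cabs x + 1 by rewrite ltr_wpDl ?cabs_ge0.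
have [|N hN] := h (e / (cabs x + 1)); first by rewrite divr_gt0.
exists N => M NM; rewrite -mulrBr cabsM; have := hN _ NM.
rewrite ltr_pdivlMr//; have := cabs_ge0 (z M - l); have := cabs_ge0 x; nra.
Qed.

Lemma cvc_sum (I : Type) (r : seq I) (z : I -> nat -> R[i]) (l : I -> R[i]) :
  (forall i, cvc (z i) (l i)) ->
  cvc (fun M => \sum_(i <- r) z i M) (\sum_(i <- r) l i).
Proof.
move=> h; elim: r => [|i r IH].
  by rewrite big_nil; under eq_fun do rewrite big_nil; exact: cvc_cst.
by rewrite big_cons; under eq_fun do rewrite big_cons; exact: cvcD.
Qed.

Lemma cvc_eventually z z' l : cvc z l ->
  (exists N, forall M, (N <= M)%N -> z M = z' M) -> cvc z' l.
Proof.
move=> h [N1 zz'] e e0; have [N hN] := h _ e0; exists (maxn N N1) => M.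
by rewrite geq_max => /andP[M1 M2]; rewrite -zz'// hN.
Qed.

Lemma cvc_Im0 z l : cvc z l ->
  (exists N, forall M, (N <= M)%N -> complex.Im (z M) = 0) -> complex.Im l = 0.
Proof.
move=> h [N1 z0]; apply/eqP; rewrite -normr_le0; apply/ler_addgt0Pl => e e0.
have [N hN] := h _ e0; rewrite addr0.
have := hN (maxn N N1) (leq_maxl _ _); rewrite cabsB => /ltW; apply: le_trans.
by have := absIm_le_cabs (l - z (maxn N N1)); rewrite Im_D Im_N z0 ?leq_maxr// subr0.
Qed.

Lemma cvc_Re_ge0 z l : cvc z l ->
  (exists N, forall M, (N <= M)%N -> 0 <= complex.Re (z M)) -> 0 <= complex.Re l.
Proof.
move=> h [N1 z0]; apply/ler_addgt0Pl => e e0; have [N hN] := h _ e0.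
have := hN (maxn N N1) (leq_maxl _ _); have := z0 (maxn N N1) (leq_maxr _ _).
by have := Re_le_cabs (z (maxn N N1) - l); rewrite Re_D Re_N; lra.
Qed.

(** Carries to the limit a bound proved for truncations of two series. In the form
    [|l1| <= sqrt (C * Re l2)] it suffices to allow an additive error [e]. *)
Lemma cvc_cabs_le z1 z2 l1 l2 (C : R) : 0 <= C -> cvc z1 l1 -> cvc z2 l2 ->
  (exists N, forall M, (N <= M)%N -> cabs (z1 M) ^+ 2 <= C * complex.Re (z2 M)) ->
  cabs l1 ^+ 2 <= C * complex.Re l2.
Proof.
move=> C0 h1 h2 [N0 hle].
have Re2 : 0 <= C * complex.Re l2 + 0.
  rewrite addr0 -[X in _ <= X](_ : complex.Re ((C%:C)%C * l2) = _); last first.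
    by rewrite Re_M/= mul0r subr0.
  apply: (cvc_Re_ge0 (cvcZ _ h2)); exists N0 => M NM.
  by rewrite Re_M/= mul0r subr0; apply: le_trans (hle _ NM); exact: sqr_ge0.
rewrite addr0 in Re2.
suff : cabs l1 <= Num.sqrt (C * complex.Re l2).
  move=> h; rewrite -[X in _ <= X]sqr_sqrtr//.
  by rewrite ler_pXn2r ?nnegrE ?cabs_ge0 ?sqrtr_ge0.
apply/ler_addgt0Pl => e e0.
have e20 : 0 < e / 2 by rewrite divr_gt0.
have C1 : 0 < C + 1 by lra.
(* Multiplied by [C], this tolerance is at most [(e / 2) ^+ 2]; the denominator [C + 1] covers
   [C = 0]. *)
have d0 : 0 < (e / 2) ^+ 2 / (C + 1) by rewrite divr_gt0// exprn_gt0.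
have [N1 k1] := h1 _ e20; have [N2 k2] := h2 _ d0.
pose M := maxn N0 (maxn N1 N2).
have M0 : (N0 <= M)%N by rewrite leq_maxl.
have M1 : (N1 <= M)%N by rewrite /M maxnCA leq_maxl.
have M2 : (N2 <= M)%N by rewrite /M (maxnC N1) maxnCA leq_maxl.
have {}k1 := k1 _ M1; have {}k2 := k2 _ M2; have {}hle := hle _ M0.
have t1 : cabs l1 <= cabs (z1 M) + cabs (z1 M - l1).
  rewrite (cabsB (z1 M)); apply: le_trans (cabsD _ _); by rewrite addrC subrK.
have t2 : complex.Re (z2 M) <= complex.Re l2 + (e / 2) ^+ 2 / (C + 1).
  by have := Re_le_cabs (z2 M - l2); rewrite Re_D Re_N; lra.
suff : cabs (z1 M) <= e / 2 + Num.sqrt (C * complex.Re l2) by lra.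
rewrite -(@ler_pXn2r _ 2) ?nnegrE ?cabs_ge0 ?addr_ge0 ?sqrtr_ge0 ?(ltW e20)//.
apply: (le_trans hle); rewrite sqrrD sqr_sqrtr//.
have : C * complex.Re (z2 M) <= C * complex.Re l2 + (e / 2) ^+ 2.
  apply: (le_trans (ler_wpM2l C0 t2)); rewrite mulrDr lerD2l mulrCA.
  by rewrite ler_piMr ?sqr_ge0// ler_pdivrMr// mul1r lerDl.
have : 0 <= e / 2 * Num.sqrt (C * complex.Re l2) by rewrite mulr_ge0 ?sqrtr_ge0// ltW.
lra.
Qed.

End ComplexLimits.

(** * Real series with bounded partial sums *)

Section BoundedSums.
Variable R : realType.
Implicit Types u v : nat -> R.

Lemma sum_nat_split (V : nmodType) (f : nat -> V) (N M : nat) : (N <= M)%N ->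
  \sum_(1 <= n < M.+1) f n =
  \sum_(1 <= n < N.+1) f n + \sum_(N.+1 <= n < M.+1) f n.
Proof. by move=> NM; rewrite -big_cat_nat. Qed.

(** Summability of a nonnegative series, stated through a bound so that no value of the sum has to
    be named. *)
Definition bsum u := exists B, forall M : nat, \sum_(1 <= n < M.+1) u n <= B.

Lemma bsumD u v : bsum u -> bsum v -> bsum (fun n => u n + v n).
Proof.
move=> [B hB] [B' hB']; exists (B + B') => M.
by rewrite big_split/= lerD.
Qed.

Lemma bsumZ x u : 0 <= x -> bsum u -> bsum (fun n => x * u n).
Proof.
move=> x0 [B hB]; exists (x * B) => M.
by rewrite -mulr_sumr ler_wpM2l.
Qed.

Lemma le_bsum u v : (forall n, (0 < n)%N -> u n <= v n) -> bsum v -> bsum u.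
Proof.
move=> uv [B hB]; exists B => M; apply: le_trans (hB M).
by apply: ler_sum_nat => n /andP[n0 _]; exact: uv.
Qed.

Lemma le_sum_nat_widen u (M L : nat) : (forall n, 0 <= u n) -> (M <= L)%N ->
  \sum_(1 <= n < M.+1) u n <= \sum_(1 <= n < L.+1) u n.
Proof.
move=> u0 ML; rewrite (sum_nat_split _ ML) lerDl.
by apply: sumr_ge0 => n _.
Qed.

Lemma le_term_sum_nat u (n L : nat) : (forall n, 0 <= u n) -> (0 < n <= L)%N ->
  u n <= \sum_(1 <= m < L.+1) u m.
Proof.
move=> u0 /andP[n0 nL]; apply: le_trans (le_sum_nat_widen u0 nL).
by rewrite big_nat_recr//= lerDr sumr_ge0.
Qed.

Lemma bsum_fin u N : (forall n, 0 <= u n) -> (forall n, (N < n)%N -> u n = 0) ->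
  bsum u.
Proof.
move=> u0 uN; exists (\sum_(1 <= n < N.+1) u n) => M.
have [MN|NM] := leqP M N; first exact: le_sum_nat_widen.
rewrite (sum_nat_split _ (ltnW NM)) gerDl.
by rewrite big_nat_cond big1// => n /andP[/andP[? ?] _]; rewrite uN.
Qed.

(** Beyond a partial sum within [e] of the supremum, any further block adds less than [e]. *)
Lemma bsum_tail u : (forall n, 0 <= u n) -> bsum u -> forall e : R, 0 < e ->
  exists N0, forall N M : nat, (N0 <= N)%N -> \sum_(N.+1 <= n < M.+1) u n < e.
Proof.
move=> u0 [B hB] e e0.
pose S := [set \sum_(1 <= n < M.+1) u n | M in [set: nat]].
have hS : has_sup S.
  split; first by exists (\sum_(1 <= n < 1) u n); exists 0%N.
  by exists B => _ [M _ <-].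
have [_ [N0 _ <-] hN0] := sup_adherent e0 hS.
exists N0 => N M N0N; have [MN|NM] := leqP M N.
  by rewrite big_geq.
have := le_sum_nat_widen u0 N0N.
have : \sum_(1 <= n < M.+1) u n <= sup S by apply: sup_upper_bound => //; exists M.
rewrite (sum_nat_split _ (ltnW NM)); lra.
Qed.

(** Telescoping: [1/n^2 <= 1/(n-1) - 1/n] for [n >= 2], so the induction carries the sharper bound
    [2 - 1/(M+1)]. *)
Lemma bsum_invn2 : bsum (fun n => (n%:R ^+ 2)^-1).
Proof.
exists 2 => M; apply: (@le_trans _ _ (\sum_(1 <= n < M.+2) (n%:R ^+ 2)^-1)).
  by apply: le_sum_nat_widen => // n; rewrite invr_ge0 sqr_ge0.
suff : \sum_(1 <= n < M.+2) (n%:R ^+ 2)^-1 <= 2 - M.+1%:R^-1 :> R.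
  by move=> /le_trans; apply; rewrite gerBl invr_ge0.
elim: M => [|M IH]; first by rewrite big_nat1 expr1n invr1; lra.
rewrite big_nat_recr//=; apply: (le_trans (lerD IH (lexx _))).
rewrite -addrA lerD2l -subr_ge0.
have -> : - M.+2%:R^-1 - (- M.+1%:R^-1 + (M.+2%:R ^+ 2)^-1) =
   (M.+1%:R * M.+2%:R ^+ 2)^-1 :> R.
  rewrite -[in M.+2%:R]natr1; set x : R := M.+1%:R.
  have x0 : 0 < x by rewrite ltr0n.
  by field; rewrite !gt_eqF//; lra.
by rewrite invr_ge0 mulr_ge0 ?sqr_ge0.
Qed.

End BoundedSums.

(** * Absolutely summable double series *)

Section DoubleSeries.
Variable R : realType.
Implicit Types (u : nat -> R[i]) (t : nat -> nat -> R[i]).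

Lemma sconvE u l : sconv u l <-> cvc (fun M => \sum_(1 <= n < M.+1) u n) l.
Proof.
by split=> h e e0; have [N hN] := h _ e0; exists N => M /hN; rewrite norm_ltC.
Qed.

Lemma abs_sconv u : bsum (fun n => cabs (u n)) -> exists l, sconv u l.
Proof.
move=> bu; have [|l hl] := @cvc_cauchy R (fun M => \sum_(1 <= n < M.+1) u n).
  move=> e e0; have [N hN] := bsum_tail (fun n => cabs_ge0 (u n)) bu e0.
  exists N => M NM; rewrite (sum_nat_split _ NM) addrAC subrr add0r.
  exact: le_lt_trans (cabs_sum _ _ _) (hN _ _ _).
by exists l; apply/sconvE.
Qed.

Lemma rect_split (V : nmodType) (t : nat -> nat -> V) P M N :
  (P <= M)%N -> (P <= N)%N ->
  \sum_(1 <= m < M.+1) \sum_(1 <= n < N.+1) t m n =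
  \sum_(1 <= m < P.+1) \sum_(1 <= n < P.+1) t m n +
  (\sum_(1 <= m < P.+1) \sum_(P.+1 <= n < N.+1) t m n +
   \sum_(P.+1 <= m < M.+1) \sum_(1 <= n < N.+1) t m n).
Proof.
move=> PM PN; rewrite (sum_nat_split _ PM) addrA; congr (_ + _).
by rewrite -big_split; apply: eq_bigr => m _; rewrite (sum_nat_split _ PN).
Qed.

Definition abs_summable t := exists B : R, forall M : nat,
  \sum_(1 <= m < M.+1) \sum_(1 <= n < M.+1) cabs (t m n) <= B.

(** Every rectangle lies in a square, so its sum of moduli is at most the supremum over squares. The
    square of side [P] comes within [e] of that supremum, hence what a larger rectangle adds to it
    is smaller than [e]. *)
Lemma abs_rect_cauchy t : abs_summable t -> forall e : R, 0 < e ->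
  exists P : nat, forall M N, (P <= M)%N -> (P <= N)%N ->
  cabs (\sum_(1 <= m < M.+1) \sum_(1 <= n < N.+1) t m n -
        \sum_(1 <= m < P.+1) \sum_(1 <= n < P.+1) t m n) < e.
Proof.
move=> [B hB] e e0.
pose g M N := \sum_(1 <= m < M.+1) \sum_(1 <= n < N.+1) cabs (t m n).
pose S := [set g M M | M in [set: nat]].
have hS : has_sup S.
  by split; [exists (g 0%N 0%N), 0%N|exists B => _ [M _ <-]; exact: hB].
have [_ [P _ <-] hP] := sup_adherent e0 hS.
exists P => M N PM PN; pose L := maxn M N.
have gL : g M N <= sup S.
  apply: (@le_trans _ _ (g L L)); last by apply: sup_upper_bound => //; exists L.
  apply: (@le_trans _ _ (g M L)).
    by apply: ler_sum => m _; apply: le_sum_nat_widen (leq_maxr _ _) => n; exact: cabs_ge0.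
  apply: (@le_sum_nat_widen _ (fun m => \sum_(1 <= n < L.+1) cabs (t m n))) (leq_maxl _ _).
  by move=> m; apply: sumr_ge0 => n _; exact: cabs_ge0.
apply: (@le_lt_trans _ _ (g M N - g P P)); last lra.
rewrite /g !(rect_split _ PM PN) ![_ + (_ + _) - _]addrC !addKr.
apply: (le_trans (cabsD _ _)); apply: lerD; apply: (le_trans (cabs_sum _ _ _));
  by apply: ler_sum => m _; exact: cabs_sum.
Qed.

Lemma abs_regular_conv t : abs_summable t -> regular_conv t.
Proof.
move=> bt; have [B hB] := bt; split; last split => n n0.
(* The square sums converge by the Cauchy criterion. A rectangle is compared with their limit
   through the squares of sides [P1] and [maxn P1 P2], at cost [e / 3] for each step. *)
- have [|l hl] := @cvc_cauchy R
    (fun M => \sum_(1 <= m < M.+1) \sum_(1 <= n < M.+1) t m n).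
    by move=> e /(abs_rect_cauchy bt)[P hP]; exists P => M PM; exact: hP.
  exists l => e e0; have e30 : 0 < e / 3 by rewrite divr_gt0.
  have [P1 h1] := abs_rect_cauchy bt e30; have [P2 h2] := hl _ e30.
  exists P1 => M N M1 N1; rewrite norm_ltC.
  have {h2} := h2 _ (leq_maxr P1 P2); rewrite cabsB.
  have := h1 _ _ (leq_maxl P1 P2) (leq_maxl P1 P2).
  have := h1 _ _ M1 N1.
  set x := \sum_(_ <= _ < M.+1) _; set y := \sum_(_ <= _ < P1.+1) _.
  set z := \sum_(_ <= _ < _) _ => xy yz zl.
  have := cabsD (x - y) (y - l); have := cabsD (y - z) (z - l).
  rewrite !addrA !subrK (cabsB y z) (cabsB z l); lra.
- apply: abs_sconv; exists B => M; apply: le_trans (hB (maxn n M)).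
  apply: (@le_trans _ _ (\sum_(1 <= i < (maxn n M).+1) cabs (t n i))).
    by apply: le_sum_nat_widen (leq_maxr _ _) => i; exact: cabs_ge0.
  apply: (@le_term_sum_nat _ (fun m => \sum_(1 <= i < (maxn n M).+1) cabs (t m i))).
    by move=> m; apply: sumr_ge0 => i _; exact: cabs_ge0.
  by rewrite n0 leq_maxl.
- apply: abs_sconv; exists B => M; apply: le_trans (hB (maxn n M)).
  apply: (@le_trans _ _ (\sum_(1 <= i < (maxn n M).+1) cabs (t i n))).
    by apply: le_sum_nat_widen (leq_maxr _ _) => i; exact: cabs_ge0.
  apply: ler_sum => i _; apply: (@le_term_sum_nat _ (fun m => cabs (t i m))).
    by move=> m; exact: cabs_ge0.
  by rewrite n0 leq_maxl.
Qed.

(** [dsum] chooses one of the limits of the double series whenever one exists; squares are the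
    rectangles with equal sides. *)
Lemma dsum_cvc t : (exists l, dconv t l) ->
  cvc (fun M => \sum_(1 <= m < M.+1) \sum_(1 <= n < M.+1) t m n) (dsum t).
Proof.
move=> [l tl]; have := xgetPex 0 (ex_intro _ l tl); rewrite -/(dsum t) => h e e0.
by have [N hN] := h _ e0; exists N => M NM; rewrite -norm_ltC; exact: hN.
Qed.

End DoubleSeries.

(** * Reproducing kernel Hilbert spaces and bounded functionals on the span of the kernel *)

Section RKHS.
Variables (R : realType) (T : Type) (K : T -> T -> R[i]).
Variables (V : set (T -> R[i])) (ip : (T -> R[i]) -> (T -> R[i]) -> R[i]).
Hypothesis HV : is_RKHS K V ip.
Implicit Types (f g : T -> R[i]) (s : seq (R[i] * T)).

Definition sqn f : R := complex.Re (ip f f).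

Lemma rkhs0 : V (fun=> 0). Proof. by case: HV. Qed.

Lemma rkhsL z f g : V f -> V g -> V (fun t => f t + z * g t).
Proof. by case: HV => _ [VD [VZ _]] Vf Vg; apply: VD => //; exact: VZ. Qed.

Lemma rkhsB f g : V f -> V g -> V (f \- g).
Proof.
move=> Vf Vg; have := rkhsL (-1) Vf Vg.
by congr V; apply/funext => t /=; rewrite mulN1r.
Qed.

Lemma ipDZl z f g h : V f -> V g -> V h ->
  ip (fun t => f t + z * g t) h = ip f h + z * ip g h.
Proof.
case: HV => _ [_ [_ [lin _]]] Vf Vg Vh; rewrite addrC -lin//.
by congr ip; apply/funext => t; rewrite addrC.
Qed.

Lemma ip_conj f g : V f -> V g -> ip f g = cconj (ip g f).
Proof. by case: HV => _ [_ [_ [_ [h _]]]]; exact: h. Qed.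

Lemma ipDZr z f g h : V f -> V g -> V h ->
  ip h (fun t => f t + z * g t) = ip h f + cconj z * ip h g.
Proof.
move=> Vf Vg Vh; rewrite ip_conj ?ipDZl//; last exact: rkhsL.
by rewrite cconjD cconjM -!ip_conj.
Qed.

Lemma ip_self f : V f -> ip f f = ((sqn f)%:C)%C.
Proof.
case: HV => _ [_ [_ [_ [_ [pos _]]]]] Vf.
have [/lec0_ReIm[im0 _] _] := pos _ Vf.
by rewrite /sqn; move: im0; case: (ip f f) => x y /= ->.
Qed.

Lemma sqn_ge0 f : V f -> 0 <= sqn f.
Proof.
case: HV => _ [_ [_ [_ [_ [pos _]]]]] Vf.
by have [/lec0_ReIm[]] := pos _ Vf.
Qed.

Lemma ip_self_lt f (e : R) : V f -> (`|ip f f| < (e%:C)%C) = (sqn f < e).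
Proof. by move=> Vf; rewrite norm_ltC ip_self// cabs_real ?sqn_ge0. Qed.

Lemma sqnDZ z f g : V f -> V g -> sqn (fun t => f t + z * g t) =
  sqn f + 2 * complex.Re (cconj z * ip f g) + cabs z ^+ 2 * sqn g.
Proof.
move=> Vf Vg; have Vfg := rkhsL z Vf Vg.
rewrite /sqn ipDZl// !ipDZr// (ip_conj Vg Vf) sqr_cabs (ip_self Vg)/=.
rewrite !(Re_D, Re_M, Im_M, Im_D, Re_cconj, Im_cconj)/=; ring.
Qed.

Lemma sqnZ z f : V f -> sqn (fun t => z * f t) = cabs z ^+ 2 * sqn f.
Proof.
move=> Vf; have := sqnDZ (z - 1) Vf Vf; rewrite ip_self// !sqr_cabs.
have -> : (fun t => f t + (z - 1) * f t) = fun t => z * f t.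
  by apply/funext => t; rewrite mulrBl mul1r addrC subrK.
by rewrite !(Re_M, Re_D, Im_D, Re_N, Im_N, Re_cconj, Im_cconj)/= => ->; ring.
Qed.

Lemma sqn0 : sqn (fun=> 0) = 0.
Proof.
by have := sqnZ 0 rkhs0; rewrite cabs0 expr0n/= !mul0r.
Qed.

Lemma sqnB f g : V f -> V g ->
  sqn (f \- g) = sqn f - 2 * complex.Re (ip f g) + sqn g.
Proof.
move=> Vf Vg; have := sqnDZ (-1) Vf Vg.
rewrite sqr_cabs !(Re_M, Re_cconj, Im_cconj, Re_N, Im_N)/=.
have -> : (fun t => f t + -1 * g t) = f \- g by apply/funext => t; rewrite mulN1r.
by move=> ->; ring.
Qed.

(** The expansions for [z] and [- z] have opposite cross terms, and the squared norm of [f - z g] is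
    nonnegative. *)
Lemma sqnD_le z f g : V f -> V g ->
  sqn (fun t => f t + z * g t) <= 2 * sqn f + 2 * cabs z ^+ 2 * sqn g.
Proof.
move=> Vf Vg; have := sqnDZ z Vf Vg; have := sqnDZ (- z) Vf Vg.
have := sqn_ge0 (rkhsL (- z) Vf Vg).
rewrite !sqr_cabs !(Re_M, Re_cconj, Im_cconj, Re_N, Im_N)/= !sqrrN; lra.
Qed.

Lemma rkhsK u : V (fun t => K t u).
Proof. by case: HV => _ [_ [_ [_ [_ [_ [_ h]]]]]]; case: (h u). Qed.

Lemma ipK f u : V f -> ip f (fun t => K t u) = f u.
Proof. by case: HV => _ [_ [_ [_ [_ [_ [_ h]]]]]] Vf; case: (h u) => _; exact. Qed.

Lemma rkhs_complete (v : nat -> T -> R[i]) : (forall n, V (v n)) ->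
  (forall e : R, 0 < e -> exists N, forall m n, (N <= m)%N -> (N <= n)%N ->
    sqn (v m \- v n) < e) ->
  exists f, V f /\ forall e : R, 0 < e -> exists N, forall n, (N <= n)%N ->
    sqn (v n \- f) < e.
Proof.
case: HV => _ [_ [_ [_ [_ [_ [compl _]]]]]] Vv cv.
have [|f [Vf hf]] := compl _ Vv.
  move=> e /cv[N hN]; exists N => m n Nm Nn.
  by rewrite ip_self_lt ?hN//; exact: rkhsB.
exists f; split=> // e /hf[N hN]; exists N => n Nn.
by rewrite -ip_self_lt ?hN//; exact: rkhsB.
Qed.

(** Cauchy-Schwarz, from the nonnegative squared norm of [f - x <f, g> g] for real [x]: take
    [x = 1 / sqn g], or a large [x] when [sqn g = 0]. *)
Lemma ip_le f g : V f -> V g -> cabs (ip f g) ^+ 2 <= sqn f * sqn g.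
Proof.
move=> Vf Vg; have f0 := sqn_ge0 Vf; have g0 := sqn_ge0 Vg.
have key (x : R) : 0 <= sqn f - 2 * x * cabs (ip f g) ^+ 2 +
    x ^+ 2 * cabs (ip f g) ^+ 2 * sqn g.
  have := sqn_ge0 (rkhsL (- ((x%:C)%C * ip f g)) Vf Vg).
  rewrite sqnDZ// !sqr_cabs !(Re_M, Im_M, Re_cconj, Im_cconj, Re_N, Im_N)/=.
  by congr (_ <= _); ring.
have [g00|gn0] := eqVneq (sqn g) 0.
  have := key ((sqn f + 1) / (cabs (ip f g) ^+ 2)); rewrite g00 !mulr0 addr0.
  have [->//|n0] := eqVneq (cabs (ip f g) ^+ 2) 0.
  by rewrite -mulrA divfK//; lra.
have := key (sqn g)^-1; rewrite -(@ler_pM2r _ (sqn g)) ?lt_def ?gn0//.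
rewrite mul0r mulrDl mulrBl.
have -> : 2 * (sqn g)^-1 * cabs (ip f g) ^+ 2 * sqn g = 2 * cabs (ip f g) ^+ 2.
  by field.
have -> : (sqn g)^-1 ^+ 2 * cabs (ip f g) ^+ 2 * sqn g * sqn g = cabs (ip f g) ^+ 2.
  by field.
lra.
Qed.

Definition kspan s : T -> R[i] := fun t => \sum_(q <- s) q.1 * K t q.2.
(** This is [<g, kspan s>] when [g] lies in [V], but it makes sense for every function [g]. *)
Definition kform g s : R[i] := \sum_(q <- s) cconj q.1 * g q.2.

Lemma kspan_cons q s : kspan (q :: s) = fun t => kspan s t + q.1 * K t q.2.
Proof. by apply/funext => t; rewrite /kspan big_cons addrC. Qed.

Lemma rkhs_kspan s : V (kspan s).
Proof.
elim: s => [|q s IH]; last by rewrite kspan_cons; apply: rkhsL => //; exact: rkhsK.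
rewrite (_ : kspan [::] = fun=> 0); first exact: rkhs0.
by apply/funext => t; rewrite /kspan big_nil.
Qed.

Lemma ip_kspan f s : V f -> ip f (kspan s) = kform f s.
Proof.
move=> Vf; elim: s => [|q s IH]; last first.
  rewrite kspan_cons ipDZr//; [|exact: rkhs_kspan|exact: rkhsK].
  by rewrite IH ipK// /kform big_cons addrC.
(* The pairing with the zero function vanishes, by linearity applied to [0 + (-1) * 0]. *)
have := ipDZr (-1) rkhs0 rkhs0 Vf; rewrite /kform big_nil.
have -> : kspan [::] = fun=> 0 by apply/funext => t; rewrite /kspan big_nil.
have -> : (fun _ : T => 0 + -1 * 0 : R[i]) = fun=> 0.
  by apply/funext => t; rewrite mulr0 addr0.
have -> : cconj (-1 : R[i]) = -1 by rewrite /cconj/= oppr0.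
by rewrite mulN1r subrr.
Qed.

Lemma sqn_kspan s : sqn (kspan s) =
  complex.Re (\sum_(q <- s) \sum_(q' <- s) cconj q.1 * q'.1 * K q.2 q'.2).
Proof.
rewrite /sqn ip_kspan; last exact: rkhs_kspan.
congr complex.Re; apply: eq_bigr => q _; rewrite /kspan mulr_sumr.
by apply: eq_bigr => q' _; rewrite mulrA.
Qed.

Section BoundedFunctional.
Variables (g : T -> R[i]) (C : R).
Hypothesis C0 : 0 <= C.
Hypothesis gC : forall s, cabs (kform g s) ^+ 2 <= C * sqn (kspan s).

(* g is recovered as the limit of a minimising sequence of J. *)
Let J s := sqn (kspan s) - 2 * complex.Re (kform g s).

(** This bounds [J] below by [- C]. It is the AM-GM inequality [2 sqrt (C x) <= x + C] with
    [x = sqn (kspan s)]. *)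
Let Re_kform_le s : 2 * complex.Re (kform g s) <= sqn (kspan s) + C.
Proof.
have n0 := sqn_ge0 (rkhs_kspan s).
apply: (@le_trans _ _ (2 * cabs (kform g s))).
  by rewrite ler_pM2l// Re_le_cabs.
rewrite -(@ler_pXn2r _ 2) ?nnegrE ?addr_ge0 ?mulr_ge0 ?cabs_ge0//.
have := gC s; have := sqr_ge0 (sqn (kspan s) - C); nra.
Qed.

Let mid s1 s2 := [seq (2^-1 * q.1, q.2) | q <- s1 ++ s2].

Let kspan_mid s1 s2 :
  kspan (mid s1 s2) = fun t => 2^-1 * (kspan s1 t + kspan s2 t).
Proof.
apply/funext => t; rewrite /kspan big_map -big_cat mulr_sumr.
by apply: eq_bigr => q _; rewrite mulrA.
Qed.

Let kform_mid s1 s2 : kform g (mid s1 s2) = 2^-1 * (kform g s1 + kform g s2).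
Proof.
rewrite /kform big_map -big_cat mulr_sumr; apply: eq_bigr => q _ /=.
rewrite cconjM mulrA; congr (_ * _ * _).
by rewrite /cconj conjc_inv conjc_nat.
Qed.

(** The linear parts of [J] cancel, leaving the parallelogram law. Since [J] at the midpoint is at
    least its infimum, minimising sequences are Cauchy. *)
Let parallelogram s1 s2 :
  sqn (kspan s1 \- kspan s2) = 2 * J s1 + 2 * J s2 - 4 * J (mid s1 s2).
Proof.
have V1 := rkhs_kspan s1; have V2 := rkhs_kspan s2.
have := sqnZ 2^-1 (rkhsL 1 V1 V2).
have -> : (fun t => 2^-1 * (kspan s1 t + 1 * kspan s2 t)) = kspan (mid s1 s2).
  by rewrite kspan_mid; apply/funext => t; rewrite mul1r.
have -> : cabs (2^-1 : R[i]) = 2^-1.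
  by apply: complexI; rewrite -norm_cabs normfV normr_nat fmorphV rmorph_nat.
rewrite sqnB// sqnDZ// /J kform_mid => ->.
have -> : cabs (1 : R[i]) = 1 by apply: complexI; rewrite -norm_cabs normr1.
have -> : complex.Re (cconj 1 * ip (kspan s1) (kspan s2)) =
          complex.Re (ip (kspan s1) (kspan s2)).
  by rewrite /cconj conjc1 mul1r.
have -> : complex.Re (2^-1 * (kform g s1 + kform g s2)) =
    2^-1 * (complex.Re (kform g s1) + complex.Re (kform g s2)).
  have -> : (2^-1 : R[i]) = ((2^-1 : R)%:C)%C by rewrite fmorphV rmorph_nat.
  by rewrite Re_M Re_D/= mul0r subr0.
lra.
Qed.

Let minJ := inf [set J s | s in [set: seq (R[i] * T)]].

Let minJ_le s : minJ <= J s.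
Proof.
apply: ge_inf; last by exists s.
by exists (- C) => _ [s' _ <-]; have := Re_kform_le s'; rewrite /J; lra.
Qed.

Let minJ_adherent (e : R) : 0 < e -> exists s, J s < minJ + e.
Proof.
move=> e0; have [|_ [s _ <-] hs] := @inf_adherent R [set J s | s in [set: seq (R[i] * T)]] e e0.
  split; first by exists (J [::]), [::].
  by exists (- C) => _ [s' _ <-]; have := Re_kform_le s'; rewrite /J; lra.
by exists s.
Qed.

(* Perturbing an almost minimiser of J by a multiple of K(., p) changes J at first
   order by the defect [kspan s p - g p], which must therefore be small. *)
Let near_minimizer s (e : R) p : 0 < e -> J s < minJ + e ->
  cabs (kspan s p - g p) ^+ 2 <= e * (complex.Re (K p p) + 1).
Proof.
move=> e0 Js; set w := kspan s p - g p; set A := complex.Re (K p p).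
have A0 : 0 <= A.
  by have := sqn_ge0 (rkhsK p); rewrite /sqn ipK//; exact: rkhsK.
(* The first-order optimal multiple would be [- w / A]; replacing [A] by [A + 1] covers [A = 0]. *)
pose x := (A + 1)^-1; pose z := - ((x%:C)%C * w).
have : minJ <= J ((z, p) :: s) by exact: minJ_le.
rewrite {1}/J kspan_cons sqnDZ; [|exact: rkhs_kspan|exact: rkhsK].
rewrite ipK; last exact: rkhs_kspan.
rewrite /= {2}/sqn ipK; last exact: rkhsK.
rewrite -/A /kform big_cons -/(kform g s) => hJ.
have cz : cabs z ^+ 2 = x ^+ 2 * cabs w ^+ 2.
  rewrite !sqr_cabs !(Re_M, Im_M, Re_N, Im_N)/=; ring.
have zw : complex.Re (cconj z * kspan s p) - complex.Re (cconj z * g p) =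
    - (x * cabs w ^+ 2).
  have -> : complex.Re (cconj z * kspan s p) - complex.Re (cconj z * g p) =
      complex.Re (cconj z * w) by rewrite mulrBr Re_D Re_N.
  rewrite !sqr_cabs !(Re_M, Im_M, Re_N, Im_N, Re_cconj, Im_cconj)/=; ring.
have x0 : 0 < x by rewrite invr_gt0; lra.
have xA : x * (A + 1) = 1 by rewrite mulVf// gt_eqF//; lra.
move: hJ Js; rewrite /J Re_D cz => hJ Js.
have w0 : 0 <= cabs w ^+ 2 by exact: sqr_ge0.
have key : 0 <= e - 2 * (x * cabs w ^+ 2) + x ^+ 2 * cabs w ^+ 2 * A by lra.
have xx : x ^+ 2 * A = x - x ^+ 2.
  by have -> : x ^+ 2 * A = x * (x * (A + 1)) - x ^+ 2 by [ring]; rewrite xA mulr1.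
have {}key : x * cabs w ^+ 2 <= e.
  have : 0 <= x ^+ 2 * cabs w ^+ 2 by rewrite mulr_ge0 ?sqr_ge0.
  move: key; rewrite [x ^+ 2 * _ * A]mulrAC xx mulrBl; lra.
have -> : cabs w ^+ 2 = x * cabs w ^+ 2 * (A + 1) by rewrite mulrAC xA mul1r.
by rewrite ler_wpM2r//; lra.
Qed.

(** A Riesz representation argument: near-minimisers of [J] converge in [V], and the limit agrees
    with [g] at every point. *)
Theorem bounded_form_rkhs : V g /\ sqn g <= C /\
  forall e : R, 0 < e -> exists s, sqn (g \- kspan s) < e.
Proof.
have [v hv] := @choice _ _ (fun n s => J s < minJ + n.+1%:R^-1)
  (fun n => minJ_adherent (etrans (invr_gt0 n.+1%:R) (ltr0Sn R n))).
have {}hv n : J (v n) < minJ + n.+1%:R^-1 := hv n.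
have small (e : R) : 0 < e -> exists N, forall n, (N <= n)%N -> n.+1%:R^-1 < e.
  move=> e0; exists (Num.bound e^-1) => n Nn.
  rewrite invf_plt ?posrE//; apply: lt_le_trans (archi_boundP _) _.
    by rewrite invr_ge0 ltW.
  by rewrite ler_nat leqW.
have [||f [Vf hf]] := @rkhs_complete (fun n => kspan (v n)).
- by move=> n; exact: rkhs_kspan.
- move=> e e0; have e40 : 0 < e / 4 by rewrite divr_gt0.
  have [N hN] := small _ e40; exists N => m n Nm Nn.
  rewrite parallelogram; have := minJ_le (mid (v m) (v n)).
  have := lt_trans (hv m) (ler_ltD (lexx minJ) (hN _ Nm)).
  have := lt_trans (hv n) (ler_ltD (lexx minJ) (hN _ Nn)); lra.
have fg : f = g.
  apply/funext => p; apply/eqP; rewrite -subr_eq0; apply/eqP/cabs0_eq0.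
  apply/eqP; rewrite -sqrf_eq0 eq_le sqr_ge0 andbT; apply/ler_addgt0Pl => e e0.
  rewrite addr0; set A := complex.Re (K p p).
  have A0 : 0 <= A.
    by have := sqn_ge0 (rkhsK p); rewrite /sqn ipK//; exact: rkhsK.
  (* At [p], the distance from [f] to [kspan (v n)] is controlled by the reproducing property and
     Cauchy-Schwarz, that from [kspan (v n)] to [g] by [near_minimizer]. Both squares are at most
     [e / 4], and [sqr_cabsD] doubles each. *)
  have d0 : 0 < e / (4 * (A + 1)) by rewrite divr_gt0//; lra.
  have [N1 h1] := small _ d0; have [N2 h2] := hf _ d0.
  pose n := maxn N1 N2.
  have Vn : V (kspan (v n)) by exact: rkhs_kspan.
  have {}h1 := h1 n (leq_maxl _ _); have {}h2 := h2 n (leq_maxr _ _).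
  have k1 := near_minimizer p d0 (lt_trans (hv n) (ler_ltD (lexx minJ) h1)).
  have := ip_le (rkhsB Vn Vf) (rkhsK p).
  rewrite ipK; last exact: rkhsB.
  rewrite /= {2}/sqn ipK -/A; last exact: rkhsK.
  move=> k2.
  have := sqr_cabsD (f p - kspan (v n) p) (kspan (v n) p - g p).
  rewrite addrA subrK (cabsB (f p)).
  have : e / (4 * (A + 1)) * (A + 1) = e / 4 by field; lra.
  have : sqn (kspan (v n) \- f) * A <= e / (4 * (A + 1)) * (A + 1).
    apply: ler_pM => //; [exact/sqn_ge0/rkhsB|exact: ltW|lra].
  by move: k1; rewrite -/A; lra.
rewrite fg in Vf hf; split=> //.
have appr e : 0 < e -> exists s, sqn (g \- kspan s) < e.
  move=> /hf[N hN]; exists (v N); have := hN N (leqnn _).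
  have Vn : V (kspan (v N)) by exact: rkhs_kspan.
  rewrite !sqnB// (ip_conj Vf Vn) Re_cconj; lra.
(* Expanding the squared norm of [g - kspan s], which is below [e], and using [Re_kform_le] gives
   [sqn g <= e + C]. *)
split=> //; apply/ler_addgt0Pl => e /appr[s].
rewrite sqnB//; last exact: rkhs_kspan.
by rewrite ip_kspan//; have := Re_kform_le s; lra.
Qed.

End BoundedFunctional.

(** For [f] in [V] the bound on [kform f] holds with [C = sqn f], by Cauchy-Schwarz. *)
Lemma rkhs_kspan_dense f (e : R) : V f -> 0 < e ->
  exists s, sqn (f \- kspan s) < e.
Proof.
move=> Vf; have [|s|_ [_]] := @bounded_form_rkhs f (sqn f); last exact.
  exact: sqn_ge0.
by rewrite -ip_kspan//; apply: ip_le => //; exact: rkhs_kspan.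
Qed.

End RKHS.

(** * The least eigenvalue as a lower bound of the quadratic form *)

Section MinEigenvalue.
Variables (R : realType) (k : nat) (b : 'M[R[i]]_k).
Hypothesis b_psd : psd_mx b.

Let Q (y : 'I_k -> R[i]) := \sum_(i < k) \sum_(j < k) b i j * y i * cconj (y j).

(** [Q] conjugates the second variable, as the kernel does, whereas [psd_mx] conjugates the first;
    the two match for [x = conj y]. *)
Lemma psd_form_ge0 y : 0 <= Q y.
Proof.
have [_ /(_ (fun i => cconj (y i)))] := b_psd; congr (_ <= _).
apply: eq_bigr => i _; apply: eq_bigr => j _.
by rewrite cconjK [y i * _]mulrC.
Qed.

Lemma form_mxE (y : 'I_k -> R[i]) (u := \row_i y i) :
  Q y = (u *m b *m map_mx (@Num.conj _) u^T) 0 0.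
Proof.
rewrite mxE /Q exchange_big/=; apply: eq_bigr => j _.
rewrite !mxE big_distrl/=; apply: eq_bigr => i _.
by rewrite !mxE [b i j * _]mulrC.
Qed.

Lemma hermitian_psd : b \is hermitianmx _ false (@Num.conj R[i]).
Proof.
apply/is_hermitianmxP; rewrite expr0 scale1r; apply/matrixP => i j.
by rewrite !mxE; case: b_psd => /(_ j i) h _; exact: h.
Qed.

(** Ensures that the set in [lambda_min] is bounded below, so that its [inf] is a genuine lower
    bound. *)
Lemma eigenvalue_psd_ge0 (r : R) : eigenvalue b ((r%:C)%C) -> 0 <= r.
Proof.
move=> /eigenvalueP[v vb v0]; have := psd_form_ge0 (fun i => v 0 i).
rewrite form_mxE (_ : \row_i v 0 i = v); last by apply/rowP => i; rewrite mxE.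
rewrite vb -scalemxAl mxE.
have : 0 < (v *m map_mx (@Num.conj _) v^T) 0 0.
  rewrite mxE; have [i vi] : exists i, v 0 i != 0 by apply/rV0Pn.
  rewrite (bigD1 i)//= !mxE -normCK ltr_wpDr ?exprn_gt0 ?normr_gt0//.
  by apply: sumr_ge0 => j _; rewrite !mxE -normCK exprn_ge0.
by move=> h; rewrite pmulr_lge0// ler0c.
Qed.

(** In the coordinates [v] of an orthonormal eigenbasis the form is a sum of [r i * |v i|^2], and
    the Euclidean norm is unchanged. Each [r i] is an eigenvalue, with row [i] of [P] as
    eigenvector. *)
Lemma lambda_min_le (y : 'I_k -> R[i]) :
  lambda_min b * \sum_(i < k) cabs (y i) ^+ 2 <= complex.Re (Q y).
Proof.
have bn := hermitian_normalmx hermitian_psd.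
have Dreal := hermitian_spectral_diag_real hermitian_psd.
have /orthomx_spectralP := bn.
have := spectral_unitarymx b; have := spectral_unit b; move: Dreal.
move: (spectralmx b) (spectral_diag b) => P D Dreal Punit Puni bE.
pose u := \row_i y i; pose v := u *m invmx P.
have Pi := invmx_unitary Puni.
pose r i := complex.Re (D 0 i).
have DE i : D 0 i = ((r i)%:C)%C.
  by have /mxOverP/(_ 0 i) := Dreal; move=> /RRe_real ->.
have lr i : lambda_min b <= r i.
  apply: ge_inf; first by exists 0 => x; exact: eigenvalue_psd_ge0.
  rewrite /= -DE; apply/eigenvalueP; exists (row i P).
    by rewrite -row_mul {1}bE !mulmxA mulmxV// mul1mx mul_diag_mx; apply/rowP => j; rewrite !mxE.
  (* A row of an invertible matrix is nonzero. *)
  apply/eqP => Pi0; have := congr1 (fun M => row i M) (mulmxV Punit).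
  rewrite row_mul Pi0 mul0mx => /rowP/(_ i); rewrite !mxE eqxx => /eqP.
  by rewrite eq_sym oner_eq0.
have vC : map_mx (@Num.conj _) v^T = P *m map_mx (@Num.conj _) u^T.
  by rewrite /v Pi trmx_mul map_mxM trmxCK.
have QE : Q y = \sum_i D 0 i * ((cabs (v 0 i) ^+ 2)%:C)%C.
  rewrite form_mxE -/u bE !mulmxA -mulmxA -vC -/v mxE; apply: eq_bigr => i _.
  by rewrite mul_mx_diag !mxE mulrAC -normCK norm_cabs rmorphXn mulrC.
have yE : \sum_i cabs (y i) ^+ 2 = \sum_i cabs (v 0 i) ^+ 2.
  apply: complexI; rewrite !rmorph_sum/=.
  transitivity ((u *m map_mx (@Num.conj _) u^T) 0 0).
    rewrite mxE; apply: eq_bigr => i _.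
    by rewrite !mxE -normCK norm_cabs rmorphXn.
  transitivity ((v *m map_mx (@Num.conj _) v^T) 0 0).
    by rewrite vC /v mulmxA mulmxKV.
  by rewrite mxE; apply: eq_bigr => i _; rewrite !mxE -normCK norm_cabs rmorphXn.
rewrite QE Re_sum yE mulr_sumr; apply: ler_sum => i _.
by rewrite Re_M/= mulr0 subr0; apply: ler_wpM2r (lr i); exact: sqr_ge0.
Qed.

End MinEigenvalue.

(** * The block matrix and the lower bound for its quadratic form *)

Section BorderedDiagonal.
Variables (R : realType) (k : nat) (b : 'M[R[i]]_k) (c : nat -> R[i]) (d : nat -> R).
Hypothesis abd : in_Sk b c d.
Let a := amat b c d.

Lemma amat_bb m n : (0 < m <= k)%N -> (0 < n <= k)%N -> a m n = bentry b m n.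
Proof. by case: m n => [|m] [|n]//= mk nk; rewrite /a /amat/= mk nk. Qed.

Lemma amat_bc m n : (0 < m <= k)%N -> (k < n)%N -> a m n = c n.
Proof.
by case: m n => [|m] [|n]//= mk nk; rewrite /a /amat/= mk [(n < k)%N]ltnNge -ltnS nk.
Qed.

Lemma amat_cb m n : (k < m)%N -> (0 < n <= k)%N -> a m n = cconj (c m).
Proof.
by case: m n => [|m] [|n]//= mk nk; rewrite /a /amat/= nk [(m < k)%N]ltnNge -ltnS mk.
Qed.

Lemma amat_dd m n : (k < m)%N -> (k < n)%N ->
  a m n = if m == n then ((d m)%:C)%C else 0.
Proof.
case: m n => [|m] [|n]//= mk nk; rewrite /a /amat/=.
by rewrite [(m < k)%N]ltnNge -ltnS mk [(n < k)%N]ltnNge -ltnS nk.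
Qed.

Lemma amat_row_top (f : nat -> R[i]) m M : (k <= M)%N -> (0 < m <= k)%N ->
  \sum_(1 <= n < M.+1) a m n * f n =
  \sum_(1 <= n < k.+1) bentry b m n * f n + \sum_(k.+1 <= n < M.+1) c n * f n.
Proof.
move=> kM mk; rewrite (sum_nat_split _ kM); congr (_ + _); apply: eq_big_nat => n nk.
  by rewrite amat_bb.
by rewrite amat_bc//; case/andP: nk.
Qed.

Lemma amat_row_bot (f : nat -> R[i]) m M : (k < m <= M)%N ->
  \sum_(1 <= n < M.+1) a m n * f n =
  cconj (c m) * \sum_(1 <= n < k.+1) f n + ((d m)%:C)%C * f m.
Proof.
move=> /andP[km mM]; rewrite (sum_nat_split _ (ltnW (leq_trans km mM))).
congr (_ + _).
  by rewrite mulr_sumr; apply: eq_big_nat => n nk; rewrite amat_cb.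
rewrite (bigD1_seq m) ?iota_uniq ?mem_index_iota ?km//= amat_dd// eqxx.
rewrite big_nat_cond big1 ?addr0// => n /andP[/andP[kn _] nm].
by rewrite amat_dd// eq_sym (negbTE nm) mul0r.
Qed.

(** The terms [|c_n|^2 / d_n], extended by zero to [n <= k] so that all sums start at 1. *)
Definition sk n : R := if (n <= k)%N then 0 else cabs (c n) ^+ 2 / d n.
Definition wt n : R := if (n <= k)%N then 1 else d n.

Lemma wt_gt0 n : 0 < wt n.
Proof.
rewrite /wt; case: leqP => // kn; by case: abd => h _; exact: h.
Qed.

Lemma sk_ge0 n : 0 <= sk n.
Proof.
rewrite /sk; case: leqP => // kn; case: abd => h _.
by rewrite divr_ge0 ?sqr_ge0// ltW// h.
Qed.

(** Term [l] of [cd_terms] is [sk] at [k + l.+1]; partial sums of nonnegative terms stay below their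
    limit. *)
Lemma sum_sk M : \sum_(1 <= n < M.+1) sk n <= limn (series (cd_terms k c d)).
Proof.
have [dk [_ cv]] := abd.
have sE n : \sum_(k.+1 <= l < (k + n).+1) sk l = series (cd_terms k c d) n.
  rewrite /series/= -[k.+1]add0n big_addn subSS addKn.
  apply: eq_big_nat => l _.
  have kl : (l + k.+1 = k + l.+1)%N by rewrite !addnS addnC.
  by rewrite /sk kl leqNgt addnS ltnS leq_addr/= /cd_terms sqr_cabs addnS.
have nd : nondecreasing_seq (series (cd_terms k c d)).
  apply/nondecreasing_seqP => n; rewrite -!sE addnS [leRHS]big_nat_recr/= ?lerDl ?sk_ge0//.
  by rewrite ltnS leq_addr.
apply: (@le_trans _ _ (\sum_(1 <= n < (k + M).+1) sk n)).
  by apply: le_sum_nat_widen; [exact: sk_ge0|exact: leq_addl].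
rewrite (sum_nat_split _ (leq_addr M k)) sE big_nat_cond big1 ?add0r.
  exact: nondecreasing_cvgn_le.
by move=> n /andP[/andP[_ nk] _]; rewrite /sk -ltnS nk.
Qed.

Lemma bsum_sk : bsum sk.
Proof. by exists (limn (series (cd_terms k c d))) => M; exact: sum_sk. Qed.

Definition wnorm M (y : nat -> R[i]) : R :=
  \sum_(1 <= n < M.+1) wt n * cabs (y n) ^+ 2.

Definition qform M (y : nat -> R[i]) : R[i] :=
  \sum_(1 <= m < M.+1) \sum_(1 <= n < M.+1) a m n * y m * cconj (y n).

(** The rows of the upper right block being equal, its contribution factors as [eta * zeta]; the
    lower left block gives the conjugate, and the last block the diagonal sum. *)
Lemma qformE M y (eta := \sum_(1 <= n < k.+1) y n)
    (zeta := \sum_(k.+1 <= n < M.+1) c n * cconj (y n)) : (k <= M)%N ->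
  qform M y = \sum_(i < k) \sum_(j < k) b i j * y i.+1 * cconj (y j.+1) +
    (eta * zeta + cconj (eta * zeta)) +
    (((\sum_(k.+1 <= n < M.+1) d n * cabs (y n) ^+ 2)%:C)%C).
Proof.
move=> kM.
have -> : qform M y = \sum_(1 <= m < M.+1)
    y m * \sum_(1 <= n < M.+1) a m n * cconj (y n).
  apply: eq_bigr => m _; rewrite mulr_sumr; apply: eq_bigr => n _.
  by rewrite mulrA [y m * _]mulrC.
rewrite (sum_nat_split _ kM).
have -> : \sum_(1 <= m < k.+1) y m * \sum_(1 <= n < M.+1) a m n * cconj (y n) =
    \sum_(i < k) \sum_(j < k) b i j * y i.+1 * cconj (y j.+1) + eta * zeta.
  rewrite big_add1/= big_mkord /eta big_add1/= big_mkord mulr_suml -big_split/=.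
  apply: eq_bigr => i _; rewrite amat_row_top//= ?ltn_ord// mulrDr; congr (_ + _).
  rewrite big_add1/= big_mkord mulr_sumr; apply: eq_bigr => j _.
  by rewrite /bentry/= !valK mulrA [_ * b i j]mulrC.
rewrite -!addrA; congr (_ + (_ + _)).
rewrite cconjM [cconj zeta]cconj_sum mulr_sumr rmorph_sum -big_split/=.
apply: eq_big_nat => m /andP[km mM]; rewrite amat_row_bot ?km// -cconj_sum.
rewrite -/eta rmorphM cconjM cconjK /=.
have -> : ((cabs (y m) ^+ 2)%:C)%C = y m * cconj (y m) by rewrite mul_cconj.
ring.
Qed.

Lemma coercive : (0 < k)%N -> 0 < s_val b c d -> exists c0 : R, 0 < c0 /\
  forall M y, (k <= M)%N -> complex.Im (qform M y) = 0 /\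
    c0 * wnorm M y <= complex.Re (qform M y).
Proof.
move=> k_gt0; have [dk [b_psd _]] := abd.
rewrite /s_val; set lam := lambda_min b; set S := limn _ => s0.
have S0 : 0 <= S by apply: le_trans (sum_sk 0); rewrite big_geq.
have kR : 0 < k%:R :> R by rewrite ltr0n.
(* t |eta|^2 is absorbed by lam * Y because t k < lam, and |zeta|^2 / t by D
   because S < t. *)
pose t := (S + lam / k%:R) / 2.
have lk : S < lam / k%:R by rewrite ltr_pdivlMr// mulrC; lra.
have St : S < t by rewrite /t; lra.
have t0 : 0 < t by lra.
have tk : t * k%:R < lam by rewrite -ltr_pdivlMr// /t; lra.
have St1 : S / t < 1 by rewrite ltr_pdivrMr// mul1r.
(* These are the coefficients left in front of [Y] and [D] once the cross terms are absorbed. *)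
exists (Num.min (lam - t * k%:R) (1 - S / t)); split.
  by rewrite lt_min !subr_gt0 tk.
move=> M y kM; rewrite qformE//.
set B := \sum_(i < k) _; set eta := \sum_(1 <= n < k.+1) _.
set zeta := \sum_(k.+1 <= n < M.+1) _; set D := \sum_(k.+1 <= n < M.+1) _.
have /lec0_ReIm[B0 _] := psd_form_ge0 b_psd (fun i => y i.+1).
have Bl := lambda_min_le b_psd (fun i => y i.+1).
rewrite -/B in B0; rewrite -/B -/lam in Bl.
split; first by rewrite !Im_D Im_cconj -/B B0/=; ring.
set Y := \sum_(i < k) _ in Bl.
have W : wnorm M y = Y + D.
  rewrite /wnorm (sum_nat_split _ kM); congr (_ + _).
    rewrite big_add1 big_mkord; apply: eq_bigr => i _.
    by rewrite /wt ltn_ord mul1r.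
  by apply: eq_big_nat => n /andP[kn _]; rewrite /wt leqNgt kn.
have D0 : 0 <= D.
  rewrite /D big_nat_cond; apply: sumr_ge0 => n /andP[/andP[kn _] _].
  by rewrite mulr_ge0 ?sqr_ge0// ltW// dk.
have Y0 : 0 <= Y by apply: sumr_ge0 => i _; exact: sqr_ge0.
(* Cauchy-Schwarz against the constant 1 is where the factor [k] of [s(a)] arises. *)
have etaY : cabs eta ^+ 2 <= k%:R * Y.
  rewrite /eta big_add1 big_mkord.
  have := @csum_CS R _ (index_enum 'I_k) predT (fun=> 1) (fun=> 1)
    (fun i => y i.+1) (fun _ _ => ltr01).
  have -> : cabs (1 : R[i]) = 1 by apply: complexI; rewrite -norm_cabs normr1.
  rewrite expr1n divr1 sumr_const card_ord.
  by under eq_bigr do rewrite mul1r; under [X in _ <= _ * X]eq_bigr do rewrite mul1r.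
have zetaD : cabs zeta ^+ 2 <= S * D.
  have := @csum_CS R _ (index_iota k.+1 M.+1) (fun n => (k < n)%N) d c
    (fun n => cconj (y n)) dk.
  (* [csum_CS] asks for positive weights where its filter holds; the filter [k < n] is automatic on
     this range and supplies that positivity for [d]. *)
  have e (V : nmodType) (F : nat -> V) : \sum_(k.+1 <= n < M.+1 | (k < n)%N) F n =
      \sum_(k.+1 <= n < M.+1) F n.
    rewrite big_nat_cond [RHS]big_nat_cond; apply: eq_bigl => n.
    by case: (ltnP k n); rewrite ?andbF ?andbT.
  rewrite !e => /le_trans; apply.
  under [X in _ * X <= _]eq_bigr do rewrite cabs_conj.
  apply: ler_wpM2r => //; apply: le_trans (sum_sk M).
  rewrite [leRHS](sum_nat_split _ kM) -[leLHS]add0r lerD ?sumr_ge0//.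
    by move=> n _; exact: sk_ge0.
  by apply: ler_sum_nat => n /andP[kn _]; rewrite /sk leqNgt kn.
have ez : - (t * cabs eta ^+ 2 + cabs zeta ^+ 2 / t) <= 2 * complex.Re (eta * zeta).
  have h1 := absRe_le_cabs (eta * zeta).
  have h2 : - cabs (eta * zeta) <= complex.Re (eta * zeta).
    by rewrite lerNl; apply: le_trans h1; rewrite -normrN ler_norm.
  have h3 : 2 * (cabs eta * cabs zeta) <= t * cabs eta ^+ 2 + cabs zeta ^+ 2 / t.
    rewrite -subr_ge0.
    have -> : t * cabs eta ^+ 2 + cabs zeta ^+ 2 / t - 2 * (cabs eta * cabs zeta)
        = (t * cabs eta - cabs zeta) ^+ 2 / t by field; rewrite gt_eqF.
    by rewrite divr_ge0 ?sqr_ge0// ltW.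
  move: h2; rewrite cabsM; lra.
rewrite !Re_D Re_cconj /= W.
have h1 : t * cabs eta ^+ 2 <= t * k%:R * Y by rewrite -mulrA ler_pM2l.
have h2 : cabs zeta ^+ 2 / t <= S / t * D by rewrite [S / t * D]mulrAC ler_pM2r ?invr_gt0.
have h3 : Num.min (lam - t * k%:R) (1 - S / t) * Y <= (lam - t * k%:R) * Y.
  by rewrite ler_wpM2r// ge_min lexx.
have h4 : Num.min (lam - t * k%:R) (1 - S / t) * D <= (1 - S / t) * D.
  by rewrite ler_wpM2r// ge_min lexx orbT.
rewrite mulrDr; move: h3 h4; rewrite !mulrBl mul1r; lra.
Qed.

End BorderedDiagonal.

(** * Conjugate and modulus of [n^{-s}] *)

Section Monomials.
Variable R : realType.
Implicit Types (s u : R[i]) (n : nat).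

Lemma npow_conj n s : npow n (cconj s) = cconj (npow n s).
Proof.
rewrite /npow cconjM Re_cconj Im_cconj !mulNr cosN sinN.
move: (expR _) (cos _) (sin _) => e x y.
by apply/eqP; rewrite eq_complex/=; apply/andP; split; apply/eqP; ring.
Qed.

Lemma cabs_npow n s : cabs (npow n s) = expR (- complex.Re s * ln n%:R).
Proof.
rewrite /npow cabsM cabs_real ?expR_ge0// -[RHS]mulr1; congr (_ * _).
set x := _ * ln _; have -> : ((cos x)%:C - 'i * (sin x)%:C)%C = (cos x -i* sin x)%C :> R[i].
  by simpc.
by rewrite /cabs/= sqrrN cos2Dsin2 sqrtr1.
Qed.

End Monomials.

(** * Convergence of the kernel series and of its Gram sums *)

Section KernelSeries.
Variables (R : realType) (k : nat) (b : 'M[R[i]]_k) (c : nat -> R[i]) (d : nat -> R).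
Variable rho : R.
Hypothesis abd : in_Sk b c d.
Hypothesis rho_gt1 : 1 < rho.
Hypothesis d_growth : exists (C0 : R) (N : nat), forall l : nat, (N <= l)%N ->
  (k < l)%N -> d l <= C0 * (l%:R `^ (rho - 1)).
Let a := amat b c d.

Definition dk n : R := if (n <= k)%N then 0 else d n.

Lemma dk_ge0 n : 0 <= dk n.
Proof. by rewrite /dk; case: leqP => // kn; case: abd => h _; exact/ltW/h. Qed.

Lemma bsum_dk s : rho < complex.Re s -> bsum (fun n => dk n * cabs (npow n s) ^+ 2).
Proof.
move=> rs; have [C0 [N hN]] := d_growth.
pose u n := dk n * cabs (npow n s) ^+ 2.
have u0 n : 0 <= u n by rewrite mulr_ge0 ?dk_ge0 ?sqr_ge0.
(* The growth bound starts at [N], so earlier terms are kept as they are; [|C0|] keeps the majorant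
   nonnegative whatever the sign of [C0]. *)
apply: (@le_bsum _ _ (fun n => (if (n <= N)%N then u n else 0) +
    `|C0| * (n%:R ^+ 2)^-1)); last first.
  apply: bsumD; last by apply: bsumZ => //; exact: bsum_invn2.
  by apply: (@bsum_fin _ _ N) => [n|n]; [case: ifP|rewrite ltnNge => /negbTE ->].
move=> n n0; case: leqP => [nN|Nn].
  by rewrite lerDl mulr_ge0// invr_ge0 sqr_ge0.
rewrite add0r /dk; case: leqP => [_|kn].
  by rewrite mul0r mulr_ge0// invr_ge0 sqr_ge0.
have n1 : 0 < n%:R :> R by rewrite ltr0n.
have ln0 : 0 <= ln n%:R :> R by rewrite ln_ge0// ler1n.
rewrite cabs_npow -expRM_natl.
have dn := hN _ (ltnW Nn) kn.
have dn' : d n <= `|C0| * n%:R `^ (rho - 1).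
  by apply: (le_trans dn); rewrite ler_wpM2r ?powR_ge0// ler_norm.
apply: (le_trans (ler_wpM2r (expR_ge0 _) dn')).
rewrite -mulrA ler_wpM2l// /powR gt_eqF// -expRD.
(* the exponent rho - 1 - 2 Re s is below -2 *)
have -> : (n%:R ^+ 2)^-1 = expR (- (2 * ln n%:R)) :> R.
  by rewrite expRN expRM_natl lnK// posrE.
rewrite ler_expR -subr_ge0.
have rho1 := rho_gt1.
have h : 0 <= ln n%:R * (2 * complex.Re s - rho - 1).
  by apply: mulr_ge0 => //; lra.
lra.
Qed.

Let Bb : R := \sum_(i < k) \sum_(j < k) cabs (b i j).
Let p n : R := (n <= k)%N%:R.
Let alpha n : R := if (n <= k)%N then Bb else cabs (c n).

Let Bb_ge0 : 0 <= Bb.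
Proof. by apply: sumr_ge0 => i _; apply: sumr_ge0 => j _; exact: cabs_ge0. Qed.

Let alpha_ge0 n : 0 <= alpha n.
Proof. by rewrite /alpha; case: ifP => // _; exact: cabs_ge0. Qed.

(** A majorant made of two products of a function of [m] by a function of [n], plus a diagonal, so
    that double sums of moduli factor into single sums. *)
Let cabs_amat_le m n : (0 < m)%N -> (0 < n)%N ->
  cabs (a m n) <= p m * alpha n + p n * alpha m + (if m == n then dk m else 0).
Proof.
move=> m0 n0; rewrite /p /alpha.
have delta0 : 0 <= (if m == n then dk m else 0) by case: ifP => // _; exact: dk_ge0.
case: (leqP m k) => mk; case: (leqP n k) => nk.
- rewrite /a amat_bb ?m0 ?n0// !mul1r.
  suff : cabs (bentry b m n) <= Bb by have := Bb_ge0; lra.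
  case: m n m0 n0 mk nk {delta0} => [|m] [|n]// _ _ mk nk.
  rewrite /bentry/= !insubT/= /Bb (bigD1 (Ordinal mk))//= (bigD1 (Ordinal nk))//=.
  rewrite -addrA lerDl addr_ge0 ?sumr_ge0// => i _; rewrite ?cabs_ge0//.
  by apply: sumr_ge0 => j _; exact: cabs_ge0.
- by rewrite /a amat_bc ?m0// mul1r mul0r addr0 lerDl.
- by rewrite /a amat_cb ?n0// cabs_conj mul1r mul0r add0r lerDl.
- rewrite /a amat_dd// !mul0r !add0r; case: eqP => [mn|_]; last by rewrite cabs0.
  by rewrite /dk leqNgt mk/= cabs_real//; case: abd => h _; exact/ltW/h.
Qed.

Let bsum_p (x : nat -> R) : (forall n, 0 <= x n) -> bsum (fun n => p n * x n).
Proof.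
move=> x0; apply: (@bsum_fin _ _ k) => [n|n kn]; first by rewrite mulr_ge0.
by rewrite /p leqNgt kn mul0r.
Qed.

(** For [n > k], AM-GM bounds [|c_n| y] by [|c_n|^2 / d_n + d_n y^2] with [y = |n^{-s}|], and both
    series are summable. *)
Let bsum_alpha s : rho < complex.Re s -> bsum (fun n => alpha n * cabs (npow n s)).
Proof.
move=> rs.
apply: (@le_bsum _ _ (fun n => p n * (Bb * cabs (npow n s)) +
    (sk k c d n + dk n * cabs (npow n s) ^+ 2))); last first.
  apply: bsumD; first by apply: bsum_p => n; rewrite mulr_ge0 ?cabs_ge0.
  by apply: bsumD; [exact: bsum_sk abd|exact: bsum_dk].
move=> n _; rewrite /alpha /p /sk /dk; case: leqP => nk.
  by rewrite mul1r mul0r !addr0.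
have dn : 0 < d n by case: abd => h _; exact: h.
rewrite mul0r add0r; set x := cabs (c n); set y := cabs _.
rewrite -subr_ge0.
have -> : x ^+ 2 / d n + d n * y ^+ 2 - x * y =
  ((x - d n * y) ^+ 2 / d n + (x ^+ 2 / d n + d n * y ^+ 2)) / 2.
  by field; rewrite gt_eqF.
have xd : 0 <= x ^+ 2 / d n by rewrite divr_ge0 ?sqr_ge0 ?ltW.
have yd : 0 <= d n * y ^+ 2 by rewrite mulr_ge0 ?sqr_ge0 ?ltW.
have xyd : 0 <= (x - d n * y) ^+ 2 / d n by rewrite divr_ge0 ?sqr_ge0 ?ltW.
lra.
Qed.

(** By [cabs_amat_le] the square sums are bounded by two products of single sums and a diagonal
    series, the latter handled by [X Y <= X^2 + Y^2]. *)
Lemma amat_abs_summable s u : rho < complex.Re s -> rho < complex.Re u ->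
  abs_summable (fun m n => a m n * npow m s * npow n u).
Proof.
move=> rs ru.
pose X n := cabs (npow n s); pose Y n := cabs (npow n u).
have X0 n : 0 <= X n by exact: cabs_ge0.
have Y0 n : 0 <= Y n by exact: cabs_ge0.
have [B1 h1] := bsum_p X0; have [B2 h2] := bsum_alpha ru.
have [B3 h3] := bsum_p Y0; have [B4 h4] := bsum_alpha rs.
have [B5 h5] : bsum (fun n => dk n * (X n * Y n)).
  apply: (@le_bsum _ _ (fun n => dk n * X n ^+ 2 + dk n * Y n ^+ 2)).
    move=> n _; rewrite -mulrDr ler_wpM2l ?dk_ge0//.
    have := X0 n; have := Y0 n; have := sqr_ge0 (X n - Y n); nra.
  by apply: bsumD; exact: bsum_dk.
exists (B1 * B2 + B4 * B3 + B5) => M.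
pose S (F : nat -> R) := \sum_(1 <= n < M.+1) F n.
have prod F G : \sum_(1 <= m < M.+1) \sum_(1 <= n < M.+1) F m * G n = S F * S G.
  by rewrite /S mulr_suml; apply: eq_bigr => m _; rewrite mulr_sumr.
apply: (@le_trans _ _ (\sum_(1 <= m < M.+1) \sum_(1 <= n < M.+1)
   (p m * X m * (alpha n * Y n) + alpha m * X m * (p n * Y n) +
    (if m == n then dk m * (X m * Y m) else 0)))).
  apply: ler_sum_nat => m /andP[m0 _]; apply: ler_sum_nat => n /andP[n0 _].
  rewrite (cabsM (a m n * _)) (cabsM (a m n)) -/(X m) -/(Y n) -mulrA.
  apply: (le_trans (ler_wpM2r (mulr_ge0 (X0 m) (Y0 n)) (cabs_amat_le m0 n0))).
  rewrite le_eqVlt; apply/orP; left; apply/eqP.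
  by case: eqP => [->|_]; ring.
under eq_bigr do rewrite !big_split/=.
rewrite !big_split/= !prod; apply: lerD; last first.
  apply: le_trans (h5 M); rewrite le_eqVlt; apply/orP; left; apply/eqP.
  apply: eq_big_nat => m mM; rewrite (bigD1_seq m) ?iota_uniq ?mem_index_iota//= eqxx.
  by rewrite big1 ?addr0// => n; rewrite eq_sym => /negbTE ->.
have S0 F : (forall n, 0 <= F n) -> 0 <= S F.
  by move=> F0; apply: sumr_ge0 => n _; exact: F0.
have pX0 Z : (forall n, 0 <= Z n) -> forall n, 0 <= p n * Z n.
  by move=> Z0 n; rewrite mulr_ge0.
have aX0 Z : (forall n, 0 <= Z n) -> forall n, 0 <= alpha n * Z n.
  by move=> Z0 n; rewrite mulr_ge0.
apply: lerD.
  by apply: (ler_pM _ _ (h1 M) (h2 M)); apply: S0; [exact: pX0|exact: aX0].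
by apply: (ler_pM _ _ (h4 M) (h3 M)); apply: S0; [exact: aX0|exact: pX0].
Qed.

Lemma amat_dirichlet_series_kernel : dirichlet_series_kernel rho a.
Proof. by move=> s u rs ru; exact/abs_regular_conv/amat_abs_summable. Qed.

Lemma kappa_cvc (s u : Hplane rho) :
  cvc (fun M => \sum_(1 <= m < M.+1) \sum_(1 <= n < M.+1)
    a m n * npow m (sval s) * npow n (cconj (sval u))) (kernel_on rho a s u).
Proof.
apply: dsum_cvc; case: s u => [s rs] [u ru] /=.
have [] := abs_regular_conv (amat_abs_summable rs _ : abs_summable
  (fun m n => a m n * npow m s * npow n (cconj u))); last by [].
by rewrite Re_cconj.
Qed.

Definition dircomb (I : Type) (r : seq I) (x : I -> R[i]) (t : I -> Hplane rho) n :=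
  \sum_(i <- r) x i * npow n (sval (t i)).

Lemma exchange_big4 (V : nmodType) (I J : Type) (r : seq I) (q : seq J)
    (F : I -> I -> J -> J -> V) :
  \sum_(i <- r) \sum_(j <- r) \sum_(m <- q) \sum_(n <- q) F i j m n =
  \sum_(m <- q) \sum_(n <- q) \sum_(i <- r) \sum_(j <- r) F i j m n.
Proof.
under eq_bigr do rewrite exchange_big/=.
rewrite exchange_big/=; apply: eq_bigr => m _.
by under eq_bigr do rewrite exchange_big/=; rewrite exchange_big.
Qed.

(** Exchanging the finite sums turns a Gram sum of truncated kernels into [qform], which transfers
    properties of the matrix to the kernel. *)
Lemma gram_cvc (I : Type) (r : seq I) (x : I -> R[i]) (t : I -> Hplane rho) :
  cvc (fun M => qform b c d M (dircomb r x t))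
    (\sum_(i <- r) \sum_(j <- r) x i * cconj (x j) * kernel_on rho a (t i) (t j)).
Proof.
have h := @cvc_sum R I r _ _ (fun i => @cvc_sum R I r _ _
  (fun j => cvcZ (x i * cconj (x j)) (kappa_cvc (t i) (t j)))).
apply: (cvc_eventually h); exists 0%N => M _; rewrite /qform.
transitivity (\sum_(i <- r) \sum_(j <- r) \sum_(1 <= m < M.+1) \sum_(1 <= n < M.+1)
    a m n * (x i * npow m (sval (t i))) * cconj (x j * npow n (sval (t j)))).
  apply: eq_bigr => i _; apply: eq_bigr => j _.
  rewrite mulr_sumr; apply: eq_bigr => m _; rewrite mulr_sumr; apply: eq_bigr => n _.
  by rewrite npow_conj cconjM; ring.
rewrite exchange_big4; apply: eq_bigr => m _; apply: eq_bigr => n _.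
rewrite /dircomb cconj_sum mulr_sumr mulr_suml; apply: eq_bigr => i _.
by rewrite mulr_sumr.
Qed.

End KernelSeries.

(** * Linear combinations of Dirichlet polynomials *)

Section DirichletPolynomials.
Variables (R : realType) (rho : R).

(** Both coefficient sequences are padded with zeros to a common length. *)
Lemma dirpoly_lin (z : R[i]) f g : is_dirpoly rho f -> is_dirpoly rho g ->
  is_dirpoly rho (fun t => f t + z * g t).
Proof.
move=> [N1 [c1 h1]] [N2 [c2 h2]]; pose N := maxn N1 N2.
have widen M (cf : nat -> R[i]) (F : nat -> R[i]) : (M <= N)%N ->
    \sum_(1 <= n < M.+1) cf n * F n =
    \sum_(1 <= n < N.+1) (if (n <= M)%N then cf n else 0) * F n.
  move=> MN; rewrite [RHS](sum_nat_split _ MN) [X in _ + X]big_nat_cond.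
  rewrite [X in _ + X]big1 ?addr0.
    by apply: eq_big_nat => n /andP[_]; rewrite ltnS => ->.
  by move=> n /andP[/andP[Mn _] _]; rewrite leqNgt Mn mul0r.
exists N, (fun n => (if (n <= N1)%N then c1 n else 0) +
  z * (if (n <= N2)%N then c2 n else 0)) => t.
rewrite h1 h2 (widen N1) ?leq_maxl// (widen N2) ?leq_maxr// mulr_sumr -big_split/=.
by apply: eq_bigr => n _; rewrite mulrDl mulrA.
Qed.

Lemma dirpoly0 : is_dirpoly rho (fun=> 0).
Proof. by exists 0%N, (fun=> 0) => t; rewrite big_geq. Qed.

End DirichletPolynomials.

(** * Weighted Cauchy estimate for square truncations of the kernel *)

Section SquareTruncation.
Variables (R : realType) (k : nat) (b : 'M[R[i]]_k) (c : nat -> R[i]) (d : nat -> R).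
Hypothesis abd : in_Sk b c d.
Let a := amat b c d.

(* With v_n = n^{- conj u}, these are the coefficients of the Dirichlet polynomial
   in s obtained by truncating kappa(s, u) to the square m, n <= N. *)
Definition trunc_coef (v : nat -> R[i]) N m : R[i] :=
  if (m <= N)%N then \sum_(1 <= n < N.+1) a m n * v n else 0.

(** Rows [m <= k] change by a tail of [c n * v n], small by Cauchy-Schwarz. Rows [k < m <= N] do not
    change, since their entries vanish outside the first [k] columns and the diagonal. Rows beyond
    [N] contribute tails of [sk] and of the weighted [v]. *)
Lemma trunc_coef_cauchy (v : nat -> R[i]) (e : R) : 0 < e ->
  bsum (fun n => dk k d n * cabs (v n) ^+ 2) ->
  exists N : nat, forall M : nat, (N <= M)%N ->
    \sum_(1 <= m < M.+1) cabs (trunc_coef v M m - trunc_coef v N m) ^+ 2 / wt k d m <= e.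
Proof.
move=> e0 bv.
pose sigma := \sum_(1 <= n < k.+1) v n.
(* [A] adds up the factors of [del] in the final bound: [k] from the top rows, the rest from the
   rows beyond [N]. Taking [del <= 1] makes [T1 * T2 <= del]. *)
pose A : R := k%:R + 2 * cabs sigma ^+ 2 + 2.
have A0 : 2 <= A by rewrite /A; have := sqr_ge0 (cabs sigma); have := ler0n R k; lra.
pose del := Num.min 1 (e / A).
have del0 : 0 < del by rewrite lt_min ltr01 divr_gt0//; lra.
have del1 : del <= 1 by rewrite ge_min lexx.
have delA : del * A <= e by rewrite -ler_pdivlMr ?ge_min ?lexx ?orbT//; lra.
have dv0 n : 0 <= dk k d n * cabs (v n) ^+ 2.
  by rewrite mulr_ge0 ?sqr_ge0//; exact: (dk_ge0 abd).
have [N1 h1] := bsum_tail (sk_ge0 abd) (bsum_sk abd) del0.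
have [N2 h2] := bsum_tail dv0 bv del0.
pose N := maxn k (maxn N1 N2).
have kN : (k <= N)%N by rewrite leq_maxl.
exists N => M NM; have kM := leq_trans kN NM.
have {}h1 := h1 N M (leq_trans (leq_maxl _ _) (leq_maxr _ _)).
have {}h2 := h2 N M (leq_trans (leq_maxr _ _) (leq_maxr _ _)).
set T1 := \sum_(N.+1 <= n < M.+1) sk k c d n in h1.
set T2 := \sum_(N.+1 <= n < M.+1) _ in h2.
have T10 : 0 <= T1 by apply: sumr_ge0 => n _; exact: (sk_ge0 abd).
have T20 : 0 <= T2 by apply: sumr_ge0 => n _; exact: dv0.
have top m : (0 < m <= k)%N ->
    cabs (trunc_coef v M m - trunc_coef v N m) ^+ 2 / wt k d m <= T1 * T2.
  move=> mk; have /andP[_ mk'] := mk.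
  rewrite /trunc_coef (leq_trans mk' kN) (leq_trans mk' kM) /a.
  rewrite !(amat_row_top b c d)// /wt mk' divr1.
  rewrite [X in _ + X - _](@big_cat_nat _ _ _ N.+1)//= opprD addrACA subrr add0r.
  rewrite addrAC subrr add0r big_nat_cond.
  rewrite (@eq_bigl _ _ _ _ _ _ (fun n => (N < n < M.+1)%N && (k < n)%N)); last first.
    move=> n; rewrite andbT; case: (ltnP N n) => //= Nn.
    by rewrite (leq_ltn_trans kN Nn) andbT.
  have dpos n : (N < n < M.+1)%N && (k < n)%N -> 0 < d n.
    by case: abd => hd _ /andP[_ kn]; exact: hd.
  apply: (le_trans (csum_CS _ _ _ dpos)).
  rewrite le_eqVlt; apply/orP; left; apply/eqP; rewrite /T1 /T2.
  rewrite [in RHS]big_nat_cond [in X in _ = _ * X]big_nat_cond.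
  congr (_ * _); apply: eq_big => n; rewrite ?andbT.
  - by case: (ltnP N n) => //= Nn; rewrite (leq_ltn_trans kN Nn) andbT.
  - by move=> /andP[_ kn]; rewrite /sk leqNgt kn.
  - by case: (ltnP N n) => //= Nn; rewrite (leq_ltn_trans kN Nn) andbT.
  - by move=> /andP[_ kn]; rewrite /dk leqNgt kn.
have mid m : (k < m <= N)%N ->
    cabs (trunc_coef v M m - trunc_coef v N m) ^+ 2 / wt k d m = 0.
  move=> /andP[km mN]; rewrite /trunc_coef mN (leq_trans mN NM) /a.
  rewrite !(amat_row_bot b c d) ?km ?mN ?(leq_trans mN NM)//.
  by rewrite subrr cabs0 expr0n mul0r.
have bot m : (N < m <= M)%N ->
    cabs (trunc_coef v M m - trunc_coef v N m) ^+ 2 / wt k d m <=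
    2 * cabs sigma ^+ 2 * sk k c d m + 2 * (dk k d m * cabs (v m) ^+ 2).
  move=> /andP[Nm mM]; have km := leq_ltn_trans kN Nm.
  have dm : 0 < d m by case: abd => hd _; exact: hd.
  rewrite /trunc_coef mM leqNgt Nm/= subr0 /a (amat_row_bot b c d) ?km// -/sigma.
  rewrite /wt /sk /dk leqNgt km/= ler_pdivrMr//.
  apply: (le_trans (sqr_cabsD _ _)); rewrite !cabsM cabs_conj (cabs_real (ltW dm)).
  rewrite le_eqVlt; apply/orP; left; apply/eqP; field; exact: lt0r_neq0.
rewrite (sum_nat_split _ NM) (sum_nat_split _ kN).
have -> : \sum_(k.+1 <= m < N.+1)
    cabs (trunc_coef v M m - trunc_coef v N m) ^+ 2 / wt k d m = 0.
  by rewrite big_nat_cond big1// => m /andP[mk _]; exact: mid.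
have S1 : \sum_(1 <= m < k.+1)
    cabs (trunc_coef v M m - trunc_coef v N m) ^+ 2 / wt k d m <= k%:R * (T1 * T2).
  apply: (@le_trans _ _ (\sum_(1 <= m < k.+1) T1 * T2)).
    by apply: ler_sum_nat => m mk; exact: top.
  by rewrite sumr_const_nat subn1/= mulr_natl.
have S2 : \sum_(N.+1 <= m < M.+1)
    cabs (trunc_coef v M m - trunc_coef v N m) ^+ 2 / wt k d m <=
    2 * cabs sigma ^+ 2 * T1 + 2 * T2.
  rewrite /T1 /T2 !mulr_sumr -big_split/=.
  by apply: ler_sum_nat => m mM; exact: bot.
have T12 : k%:R * (T1 * T2) <= k%:R * del.
  by rewrite ler_wpM2l//; nra.
have sT : 2 * cabs sigma ^+ 2 * T1 <= 2 * cabs sigma ^+ 2 * del.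
  by apply: ler_wpM2l; [rewrite mulr_ge0 ?sqr_ge0|exact: ltW].
apply: le_trans delA; rewrite /A; lra.
Qed.

End SquareTruncation.

(** * Membership and density of Dirichlet polynomials in the kernel space *)

Section KernelSpace.
Variables (R : realType) (k : nat) (b : 'M[R[i]]_k) (c : nat -> R[i]) (d : nat -> R).
Variable rho : R.
Hypothesis abd : in_Sk b c d.
Hypothesis rho_gt1 : 1 < rho.
Hypothesis d_growth : exists (C0 : R) (N : nat), forall l : nat, (N <= l)%N ->
  (k < l)%N -> d l <= C0 * (l%:R `^ (rho - 1)).
Variable c0 : R.
Hypothesis c0_gt0 : 0 < c0.
Hypothesis c0_coercive : forall M y, (k <= M)%N ->
  complex.Im (qform b c d M y) = 0 /\
  c0 * wnorm k d M y <= complex.Re (qform b c d M y).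
Let a := amat b c d.
Let K := kernel_on rho a.

Lemma wnorm_ge0 M y : 0 <= wnorm k d M y.
Proof.
by apply: sumr_ge0 => n _; rewrite mulr_ge0 ?sqr_ge0// ltW//; exact: (wt_gt0 abd).
Qed.

(** Gram sums are limits of values of [qform], which are real and nonnegative once [M >= k]. *)
Lemma amat_psd_kernel : psd_kernel K.
Proof.
move=> N p x; have h := gram_cvc abd rho_gt1 d_growth (index_enum 'I_N) x p.
apply/lec0_ReIm; split.
  by apply: (cvc_Im0 h); exists k => M kM; have [] := c0_coercive (dircomb (index_enum 'I_N) x p) kM.
apply: (cvc_Re_ge0 h); exists k => M kM.
have [_] := c0_coercive (dircomb (index_enum 'I_N) x p) kM; apply: le_trans.
by rewrite mulr_ge0 ?wnorm_ge0// ltW.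
Qed.

Variables (V : set (Hplane rho -> R[i]))
  (ip : (Hplane rho -> R[i]) -> (Hplane rho -> R[i]) -> R[i]).
Hypothesis HV : is_RKHS K V ip.
Implicit Types (f g : Hplane rho -> R[i]) (s : seq (R[i] * Hplane rho)).

(** The sequence [y_n] of a combination of kernel functions, that is, [dircomb] with conjugated
    coefficients. *)
Definition kcoef s n := kform (fun t : Hplane rho => npow n (sval t)) s.

(** The bound is asked only of approximations [z M], because [g] may be an infinite series;
    coercivity and passage to the limit then give the hypothesis of [bounded_form_rkhs]. *)
Lemma rkhs_bounded_coef g (C : R) : 0 <= C ->
  (forall s, exists z, cvc z (kform g s) /\ exists N, forall M, (N <= M)%N ->
    cabs (z M) ^+ 2 <= C * wnorm k d M (kcoef s)) ->
  V g /\ sqn ip g <= C / c0.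
Proof.
move=> C0 hg; have Cc0 : 0 <= C / c0 by rewrite divr_ge0// ltW.
suff gC s : cabs (kform g s) ^+ 2 <= C / c0 * sqn ip (kspan K s).
  by have [Vg [gle _]] := bounded_form_rkhs HV Cc0 gC.
have [z [zg [N hN]]] := hg s; rewrite (sqn_kspan HV).
have h := gram_cvc abd rho_gt1 d_growth s (fun q => cconj q.1) snd.
have -> : \sum_(q <- s) \sum_(q' <- s) cconj q.1 * q'.1 * K q.2 q'.2 =
    \sum_(q <- s) \sum_(q' <- s) cconj q.1 * cconj (cconj q'.1) * K q.2 q'.2.
  by apply: eq_bigr => q _; apply: eq_bigr => q' _; rewrite cconjK.
apply: (cvc_cabs_le Cc0 zg h); exists (maxn N k) => M.
rewrite geq_max => /andP[NM kM]; apply: (le_trans (hN _ NM)).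
rewrite -mulrA ler_wpM2l// ler_pdivlMl//.
by have [_] := c0_coercive (kcoef s) kM.
Qed.

(** The single term [n] of the weighted norm already dominates, with constant [1 / w_n]. *)
Lemma rkhs_monomial n : (0 < n)%N -> V (fun t => npow n (sval t)).
Proof.
move=> n0; have wn := wt_gt0 abd n.
have [|s|] := @rkhs_bounded_coef (fun t => npow n (sval t)) (wt k d n)^-1; last by [].
  by rewrite invr_ge0 ltW.
exists (fun=> kcoef s n); split; first exact: cvc_cst.
exists n => M nM; rewrite ler_pdivlMl//.
apply: (@le_term_sum_nat _ (fun n => wt k d n * cabs (kcoef s n) ^+ 2)).
  by move=> m; rewrite mulr_ge0 ?sqr_ge0// ltW//; exact: (wt_gt0 abd).
by rewrite n0.
Qed.

Lemma rkhs_dirpoly f : is_dirpoly rho f -> V f.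
Proof.
move=> [N [cf fE]]; have -> : f = fun t => \sum_(1 <= n < N.+1) cf n * npow n (sval t).
  exact/funext.
elim: N {fE} => [|N IH].
  rewrite (_ : (fun _ => _) = fun=> 0); first exact: (rkhs0 HV).
  by apply/funext => t; rewrite big_geq.
rewrite (_ : (fun _ => _) = fun t => \sum_(1 <= n < N.+1) cf n * npow n (sval t) +
    cf N.+1 * npow N.+1 (sval t)).
  by apply: (rkhsL HV) => //; exact: rkhs_monomial.
by apply/funext => t; rewrite big_nat_recr.
Qed.

(** [K(., u) - p] is the pointwise limit of the polynomials [S M - p], whose coefficients are
    controlled by [trunc_coef_cauchy] and weighted Cauchy-Schwarz. *)
Lemma kernel_dirpoly_approx (u : Hplane rho) (e : R) : 0 < e ->
  exists p, is_dirpoly rho p /\ sqn ip ((fun t => K t u) \- p) < e.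
Proof.
move=> e0; pose v n := npow n (cconj (sval u)).
have bv : bsum (fun n => dk k d n * cabs (v n) ^+ 2).
  apply: (bsum_dk abd rho_gt1 d_growth); rewrite Re_cconj; exact: (svalP u).
(* The factor [c0] cancels the division in [rkhs_bounded_coef], and halving makes the final
   inequality strict. *)
have e1 : 0 < e * c0 / 2 by rewrite divr_gt0// mulr_gt0.
have [N hN] := trunc_coef_cauchy abd e1 bv.
pose coef := trunc_coef b c d v.
pose p (t : Hplane rho) := \sum_(1 <= m < N.+1) coef N m * npow m (sval t).
exists p; split; first by exists N, (coef N).
have [|s|_ h] := @rkhs_bounded_coef ((fun t => K t u) \- p) (e * c0 / 2); first exact: ltW.
  pose S M (t : Hplane rho) := \sum_(1 <= m < M.+1) coef M m * npow m (sval t).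
  exists (fun M => kform (S M \- p) s); split.
    rewrite /kform; apply: cvc_sum => q; apply: cvcZ; apply: cvcD; last exact: cvc_cst.
    apply: (cvc_eventually (kappa_cvc abd rho_gt1 d_growth q.2 u)); exists 0%N => M _.
    apply: eq_big_nat => m /andP[_ mM]; rewrite /coef /trunc_coef -ltnS mM mulr_suml.
    by apply: eq_bigr => n _; rewrite -/a mulrAC.
  exists N => M NM.
  have -> : kform (S M \- p) s =
      \sum_(1 <= m < M.+1) (coef M m - coef N m) * kcoef s m.
    have pE t : p t = \sum_(1 <= m < M.+1) coef N m * npow m (sval t).
      rewrite (sum_nat_split _ NM) [X in _ + X]big_nat_cond.
      rewrite [X in _ + X]big1 ?addr0// => m /andP[/andP[Nm _] _].
      by rewrite /coef /trunc_coef leqNgt Nm mul0r.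
    under [RHS]eq_bigr do rewrite /kcoef /kform mulr_sumr.
    rewrite exchange_big/=; apply: eq_bigr => q _.
    rewrite /= pE -sumrB mulr_sumr; apply: eq_bigr => m _; ring.
  apply: (le_trans (csum_CS _ _ _ (fun i _ => wt_gt0 abd i))).
  by rewrite ler_wpM2r ?wnorm_ge0// hN.
apply: (le_lt_trans h); rewrite mulrAC mulfK ?gt_eqF//; lra.
Qed.

Lemma kspan_dirpoly_approx s (e : R) : 0 < e ->
  exists p, is_dirpoly rho p /\ sqn ip (kspan K s \- p) < e.
Proof.
elim: s e => [|q s IH] e e0.
  exists (fun=> 0); split; first exact: dirpoly0.
  rewrite (_ : _ \- _ = fun=> 0) ?(sqn0 HV)//.
  by apply/funext => t; rewrite /kspan/= big_nil subr0.
have C0 : 0 < cabs q.1 ^+ 2 + 1 by rewrite ltr_wpDl ?sqr_ge0.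
have [p1 [dp1 h1]] := IH (e / 4) (divr_gt0 e0 (ltr0Sn _ _)).
(* With these tolerances [sqnD_le] gives less than [e / 2] plus at most [e / 2]; the added 1 covers
   a zero coefficient. *)
have [|p2 [dp2 h2]] := @kernel_dirpoly_approx q.2 (e / (4 * (cabs q.1 ^+ 2 + 1))).
  by rewrite divr_gt0// mulr_gt0.
exists (fun t => p1 t + q.1 * p2 t); split; first exact: dirpoly_lin.
have Vs := rkhsB HV (rkhs_kspan HV s) (rkhs_dirpoly dp1).
have Vq := rkhsB HV (rkhsK HV q.2) (rkhs_dirpoly dp2).
rewrite (_ : _ \- _ = fun t => (kspan K s \- p1) t + q.1 * ((fun t => K t q.2) \- p2) t).
  apply: (le_lt_trans (sqnD_le HV _ Vs Vq)).
  have h3 : cabs q.1 ^+ 2 * sqn ip ((fun t => K t q.2) \- p2) <= e / 4.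
    apply: (@le_trans _ _ ((cabs q.1 ^+ 2 + 1) * (e / (4 * (cabs q.1 ^+ 2 + 1))))).
      by apply: ler_pM; rewrite ?sqr_ge0 ?(sqn_ge0 HV Vq) ?lerDl// ltW.
    by rewrite le_eqVlt; apply/orP; left; apply/eqP; field; rewrite gt_eqF.
  lra.
by apply/funext => t; rewrite kspan_cons /=; ring.
Qed.

Lemma dirpoly_dense f (e : R) : V f -> 0 < e ->
  exists p, is_dirpoly rho p /\ sqn ip (f \- p) < e.
Proof.
move=> Vf e0; have e40 : 0 < e / 4 by rewrite divr_gt0.
have [s hs] := rkhs_kspan_dense HV Vf e40.
have [p [dp hp]] := kspan_dirpoly_approx s e40.
exists p; split=> //.
have V1 := rkhsB HV Vf (rkhs_kspan HV s).
have V2 := rkhsB HV (rkhs_kspan HV s) (rkhs_dirpoly dp).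
rewrite (_ : _ \- _ = fun t => (f \- kspan K s) t + 1 * (kspan K s \- p) t).
  apply: (le_lt_trans (sqnD_le HV _ V1 V2)).
  have -> : cabs (1 : R[i]) = 1 by apply: complexI; rewrite -norm_cabs normr1.
  by rewrite expr1n; lra.
by apply/funext => t /=; ring.
Qed.

End KernelSpace.

Theorem theorem3p5 (R : realType) (k : nat) (b : 'M[R[i]]_k)
    (c : nat -> R[i]) (d : nat -> R) (rho : R) :
  (0 < k)%N ->
  in_Sk b c d ->
  0 < s_val b c d ->
  1 < rho ->
  (exists (C0 : R) (N : nat), forall l : nat, (N <= l)%N -> (k < l)%N ->
      d l <= C0 * (l%:R `^ (rho - 1))) ->
  let a := amat b c d in
  [/\ dirichlet_series_kernel rho a,
      psd_kernel (kernel_on rho a),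
      (forall n : nat, (k < n)%N ->
         exists f : Hplane rho -> R[i], is_dirpoly rho f /\
           forall s : Hplane rho, sconv (fun m => a m n * npow m (sval s)) (f s)) &
      (forall (V : set (Hplane rho -> R[i])) (ip : (Hplane rho -> R[i]) -> (Hplane rho -> R[i]) -> R[i]),
         is_RKHS (kernel_on rho a) V ip ->
         (forall f, is_dirpoly rho f -> V f) /\
         (forall f, V f -> forall e : R, 0 < e ->
            exists p, is_dirpoly rho p /\ V p /\ `| ip (f \- p) (f \- p) | < (e%:C)%C))].
Proof.
move=> k0 abd s0 rho1 dgrowth a.
have [c0 [c00 hc0]] := coercive abd k0 s0.
split.
- exact: amat_dirichlet_series_kernel.
- exact: (amat_psd_kernel abd rho1 dgrowth c00 hc0).
- move=> n kn.
  (* For [n > k] the entries of column [n] vanish for [m > n], so the partial sums are constant from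
     [M = n] on. *)
  exists (fun t => \sum_(1 <= m < n.+1) a m n * npow m (sval t)); split.
    by exists n, (fun m => a m n).
  move=> t; apply/sconvE; apply: (cvc_eventually (cvc_cst _)).
  exists n => M nM; rewrite (sum_nat_split _ nM) [X in _ + X]big_nat_cond.
  rewrite [X in _ + X]big1 ?addr0// => m /andP[/andP[nm _] _].
  by rewrite /a amat_dd ?(ltn_trans kn nm)// gtn_eqF// mul0r.
- move=> V ip HV.
  have Vp := rkhs_dirpoly abd rho1 dgrowth c00 hc0 HV.
  split=> // f Vf e e0.
  have [p [dp hp]] := dirpoly_dense abd rho1 dgrowth c00 hc0 HV Vf e0.
  exists p; split=> //; split; first exact: Vp.
  by rewrite (ip_self_lt HV)//; apply: (rkhsB HV) => //; exact: Vp.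
Qed.
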